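(* Let $B=\mathbb{Z}[\rho]\langle x,y\rangle/(xy-\rho yx-1)$ and let $C=\mathbb{Z}[\rho][s,t]$ be its center, where $s=x^p$ and $t=y^p$. Then $B/C$ is Azumaya precisely on the open set $D(1+st\eta^p)$ of $\mathrm{Spec}\,C$; that is, for a prime $P$ of $C$, $B_P$ is an Azumaya $C_P$-algebra if and only if $1+st\eta^p\notin P$.
   Context: $p$ is a prime, $\rho$ is a primitive $p$-th root of one, $\mathbb{Z}[\rho]=\mathbb{Z}[X]/(X^{p-1}+\cdots+1)$, $\eta=\rho-1$. $\mathbb{Z}[\rho]\langle x,y\rangle$ is the free associative algebra, and $B$ is its quotient by the two-sided ideal generated by $xy-\rho yx-1$. The center $C$ of $B$ is the polynomial ring over $\mathbb{Z}[\rho]$ in $s=x^p$ and $t=y^p$, and $B$ is free of rank $p^2$ over $C$.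
   Formalization: The prime p is assumed odd; for p = 2 (ρ = −1, η = −2) the printed claim fails, since the correct element is 1 − 4st rather than 1 + stη^2 = 1 + 4st (for example at P = (3, s−1, t−2)). *)

(* Defs.v *)
From HB Require Import structures.
From mathcomp Require Import all_boot all_algebra generic_quotient.
From mathcomp Require Import boolp.
From mathcomp Require Import finmap monalg.
From mathcomp Require Import ring.

Set Implicit Arguments.
Unset Strict Implicit.
Unset Printing Implicit Defensive.

Import GRing.Theory.
Local Open Scope ring_scope.
Local Open Scope quotient_scope.

(* Localization of a C-algebra A at a prime ideal P of a commutative ring C:  *)
(* A_P is the set of fractions a / s with s outside P, where a / s = b / t    *)
(* iff u *: (t *: a) = u *: (s *: b) for some u outside P. C_P is the case    *)
(* A = C. Only rings with 1 != 0 are algebras in the library, and A_P may be  *)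
(* zero, so A_P is made an algebra over C_P only when C is the center of A.   *)

Section Localization.

Variables (C : comNzRingType) (P : prime_idealr C).

Record denom := Denom { den : C; den_notin : den \notin (P : pred C) }.
HB.instance Definition _ := [isSub for den].
HB.instance Definition _ := [Choice of denom by <:].

Lemma denom1_subproof : 1 \notin (P : pred C).
Proof. by rewrite idealr1. Qed.
Definition denom1 := Denom denom1_subproof.

Lemma denomM_subproof (s t : denom) : den s * den t \notin (P : pred C).
Proof. by rewrite prime_idealrM negb_or !den_notin. Qed.
Definition denomM s t := Denom (denomM_subproof s t).

Section Carrier.

Variable A : algType C.

Definition frac_equiv : rel (A * denom) := fun x y =>
  `[< exists u : denom,
        den u *: (den y.2 *: x.1) = den u *: (den x.2 *: y.1) >].

Lemma frac_equiv_is_equiv : equiv_class_of frac_equiv.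
Proof.
split.
- by move=> x; apply/asboolP; exists denom1.
- by move=> x y; apply/asboolP/asboolP=> -[u e]; exists u; rewrite e.
- move=> [b t] [a s] [c r] /asboolP[/= u e] /asboolP[/= v e'].
  apply/asboolP; exists (denomM (denomM u v) t) => /=.
  have {}e := congr1 ( *:%R (den v * den r)) e.
  have {}e' := congr1 ( *:%R (den u * den s)) e'.
  rewrite !scalerA in e e' *.
  transitivity ((den v * den r * den u * den t) *: a).
    by congr *:%R; ring.
  rewrite e; transitivity ((den u * den s * den v * den r) *: b).
    by congr *:%R; ring.
  by rewrite e'; congr *:%R; ring.
Qed.

Canonical frac_equiv_equiv := EquivRelPack frac_equiv_is_equiv.
Canonical frac_equiv_encModRel := defaultEncModRel frac_equiv.

Definition localization : Type := {eq_quot frac_equiv}.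
HB.instance Definition _ := Choice.on localization.

Definition frac (a : A) (s : denom) : localization := \pi_localization (a, s).

Lemma frac_eqP a s b t :
  frac a s = frac b t <->
  exists u : denom, den u *: (den t *: a) = den u *: (den s *: b).
Proof.
split.
  by move=> /eqP; rewrite /frac piE /= => /asboolP.
by move=> e; apply/eqP; rewrite /frac piE /=; apply/asboolP.
Qed.

Lemma frac_eq a s b t : den t *: a = den s *: b -> frac a s = frac b t.
Proof. by move=> e; apply/frac_eqP; exists denom1; rewrite e. Qed.

Variant loc_spec : localization -> Type :=
  LocSpec a s : loc_spec (frac a s).

Lemma locP z : loc_spec z.
Proof. by rewrite -[z]reprK; case: (repr z) => a s; apply: LocSpec. Qed.

Definition loc_lift (T : Type) (f : A -> denom -> T) (z : localization) : T :=
  f (repr z).1 (repr z).2.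

Lemma loc_liftE (T : Type) (f : A -> denom -> T) :
  (forall a s b t, frac a s = frac b t -> f a s = f b t) ->
  forall a s, loc_lift f (frac a s) = f a s.
Proof.
move=> compf a s; apply: compf; rewrite /frac.
by case: (repr (\pi_localization (a, s))) (reprK (\pi_localization (a, s))) => b t /= <-.
Qed.

Definition loc_add (z w : localization) : localization :=
  loc_lift (fun a s => loc_lift (fun b t =>
    frac (den t *: a + den s *: b) (denomM s t)) w) z.
Definition loc_opp (z : localization) : localization :=
  loc_lift (fun a s => frac (- a) s) z.
Definition loc_mul (z w : localization) : localization :=
  loc_lift (fun a s => loc_lift (fun b t => frac (a * b) (denomM s t)) w) z.

Lemma loc_addE a s b t :
  loc_add (frac a s) (frac b t) = frac (den t *: a + den s *: b) (denomM s t).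
Proof.
rewrite /loc_add loc_liftE.
  rewrite loc_liftE // => b1 t1 b2 t2 /frac_eqP[u e].
  apply/frac_eqP; exists u => /=.
  rewrite !scalerDr !scalerA in e *; congr (_ + _).
    by congr *:%R; ring.
  have {}e := congr1 ( *:%R (den s * den s)) e; rewrite !scalerA in e.
  transitivity ((den s * den s * (den u * den t2)) *: b1).
    by congr *:%R; ring.
  by rewrite e; congr *:%R; ring.
move=> a1 s1 a2 s2 /frac_eqP[u e]; case: (locP (frac b t)) => b' t'.
rewrite /loc_lift; move: (repr _).1 (repr _).2 => {}b {}t.
apply/frac_eqP; exists u => /=.
rewrite !scalerDr !scalerA in e *; congr (_ + _); last first.
  by congr *:%R; ring.
have {}e := congr1 ( *:%R (den t * den t)) e; rewrite !scalerA in e.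
transitivity ((den t * den t * (den u * den s2)) *: a1).
  by congr *:%R; ring.
by rewrite e; congr *:%R; ring.
Qed.

Lemma loc_oppE a s : loc_opp (frac a s) = frac (- a) s.
Proof.
rewrite /loc_opp loc_liftE // => b t c r /frac_eqP[u e].
by apply/frac_eqP; exists u; rewrite !scalerN e.
Qed.

Lemma loc_mulE a s b t :
  loc_mul (frac a s) (frac b t) = frac (a * b) (denomM s t).
Proof.
rewrite /loc_mul loc_liftE.
  rewrite loc_liftE // => b1 t1 b2 t2 /frac_eqP[u e].
  apply/frac_eqP; exists u => /=.
  have {}e := congr1 (fun z => den s *: (a * z)) e.
  rewrite -!scalerAr !scalerA in e *.
  transitivity ((den s * (den u * den t2)) *: (a * b1)).
    by congr *:%R; ring.
  by rewrite e; congr *:%R; ring.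
move=> a1 s1 a2 s2 /frac_eqP[u e].
rewrite /loc_lift; move: (repr _).1 (repr _).2 => {}b {}t.
apply/frac_eqP; exists u => /=.
have {}e := congr1 (fun z => den t *: (z * b)) e.
rewrite -!scalerAl !scalerA in e *.
transitivity ((den t * (den u * den s2)) *: (a1 * b)).
  by congr *:%R; ring.
by rewrite e; congr *:%R; ring.
Qed.

Lemma loc_addA : associative loc_add.
Proof.
move=> z w v; case: (locP z) (locP w) (locP v) => a s [b t] [c r].
rewrite !loc_addE; apply: frac_eq => /=; rewrite !scalerDr !scalerA addrA.
by congr (_ *: _ + _ *: _ + _ *: _); ring.
Qed.

Lemma loc_addC : commutative loc_add.
Proof.
move=> z w; case: (locP z) (locP w) => a s [b t].
by rewrite !loc_addE; apply: frac_eq; rewrite /= addrC mulrC.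
Qed.

Lemma loc_add0 : left_id (frac 0 denom1) loc_add.
Proof.
move=> z; case: (locP z) => a s; rewrite loc_addE.
by apply: frac_eq; rewrite /= scaler0 add0r scale1r mul1r.
Qed.

Lemma loc_addN : left_inverse (frac 0 denom1) loc_opp loc_add.
Proof.
move=> z; case: (locP z) => a s; rewrite loc_oppE loc_addE.
by apply: frac_eq; rewrite /= scalerN addNr !scaler0.
Qed.

HB.instance Definition _ := GRing.isZmodule.Build localization
  loc_addA loc_addC loc_add0 loc_addN.

Lemma loc_mulA : associative loc_mul.
Proof.
move=> z w v; case: (locP z) (locP w) (locP v) => a s [b t] [c r].
by rewrite !loc_mulE; apply: frac_eq; rewrite /= !mulrA.
Qed.

Lemma loc_mul1 : left_id (frac 1 denom1) loc_mul.
Proof.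
move=> z; case: (locP z) => a s.
by rewrite loc_mulE; apply: frac_eq; rewrite /= !mul1r.
Qed.

Lemma loc_mul1r : right_id (frac 1 denom1) loc_mul.
Proof.
move=> z; case: (locP z) => a s.
by rewrite loc_mulE; apply: frac_eq; rewrite /= !mulr1.
Qed.

Lemma loc_mulDl : left_distributive loc_mul loc_add.
Proof.
move=> z w v; case: (locP z) (locP w) (locP v) => a s [b t] [c r].
rewrite !(loc_addE, loc_mulE); apply: frac_eq => /=.
rewrite mulrDl !scalerDr -!scalerAl !scalerA.
by congr (_ *: _ + _ *: _); ring.
Qed.

Lemma loc_mulDr : right_distributive loc_mul loc_add.
Proof.
move=> z w v; case: (locP z) (locP w) (locP v) => a s [b t] [c r].
rewrite !(loc_addE, loc_mulE); apply: frac_eq => /=.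
rewrite mulrDr !scalerDr -!scalerAr !scalerA.
by congr (_ *: _ + _ *: _); ring.
Qed.

HB.instance Definition _ := GRing.Zmodule_isPzRing.Build localization
  loc_mulA loc_mul1 loc_mul1r loc_mulDl loc_mulDr.

Lemma fracD a s b t :
  frac a s + frac b t = frac (den t *: a + den s *: b) (denomM s t).
Proof. exact: loc_addE. Qed.

Lemma fracM a s b t : frac a s * frac b t = frac (a * b) (denomM s t).
Proof. exact: loc_mulE. Qed.

End Carrier.
End Localization.
Section LocalizedModule.

Variables (C : comNzRingType) (P : prime_idealr C).

Definition loc_ring : Type := localization P C^o.
HB.instance Definition _ := GRing.PzRing.on loc_ring.

Lemma loc_ring_mulC : commutative ( *%R : loc_ring -> loc_ring -> loc_ring).
Proof.
move=> z w; case: (locP z) (locP w) => a s [b t].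
rewrite [LHS]loc_mulE [RHS]loc_mulE.
by apply: frac_eq => /=; rewrite (mulrC (den t)) (mulrC a).
Qed.
HB.instance Definition _ :=
  GRing.PzRing_hasCommutativeMul.Build loc_ring loc_ring_mulC.

Lemma loc_ring_nonzero : 1 != 0 :> loc_ring.
Proof.
apply/eqP => /frac_eqP[u]; rewrite /= !scale1r => u0.
have := den_notin u; rewrite -[den u]mulr1.
by rewrite [_ * _]u0 [_ *: _]mulr0 idealr0.
Qed.
HB.instance Definition _ :=
  GRing.PzSemiRing_isNonZero.Build loc_ring loc_ring_nonzero.

Lemma loc_ringD (a b : C^o) s t :
  @GRing.add loc_ring (frac a s) (frac b t) =
  frac (den t *: a + den s *: b) (denomM s t).
Proof. exact: loc_addE. Qed.

Lemma loc_ringM (a b : C^o) s t :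
  @GRing.mul loc_ring (frac a s) (frac b t) = frac (a * b) (denomM s t).
Proof. exact: loc_mulE. Qed.

Variable A : algType C.
Local Notation AP := (localization P A).

Definition loc_scale (z : loc_ring) (w : AP) : AP :=
  loc_lift (A := C^o) (fun c s => loc_lift (fun a t =>
    frac ((c : C) *: a) (denomM s t)) w) z.

Lemma loc_scaleE (c : C) s (a : A) t :
  loc_scale (frac (c : C^o) s) (frac a t) = frac (c *: a) (denomM s t).
Proof.
rewrite /loc_scale loc_liftE.
  rewrite loc_liftE // => a1 t1 a2 t2 /frac_eqP[u e].
  apply/frac_eqP; exists u => /=.
  have {}e := congr1 ( *:%R (den s * c)) e.
  rewrite !scalerA in e *.
  transitivity ((den s * c * den u * den t2) *: a1).
    by congr *:%R; ring.
  by rewrite e; congr *:%R; ring.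
move=> c1 s1 c2 s2 /frac_eqP[u e].
rewrite /loc_lift; move: (repr _).1 (repr _).2 => {}a {}t.
apply/frac_eqP; exists u => /=.
have {}e : den u * (den s2 * c1) = den u * (den s1 * c2) by exact: e.
rewrite !scalerA; congr *:%R.
transitivity (den t * (den u * (den s2 * c1))); first by ring.
by rewrite e; ring.
Qed.

Lemma loc_scaleA z w v : loc_scale z (loc_scale w v) = loc_scale (z * w) v.
Proof.
case: (locP z) (locP w) (locP v) => a s [b t] [c r].
rewrite (loc_scaleE b t c r) (loc_scaleE a s) (loc_ringM a b s t) loc_scaleE.
by apply: frac_eq; rewrite /= !scalerA; congr *:%R; ring.
Qed.

Lemma loc_scale1 : left_id 1 loc_scale.
Proof.
move=> z; case: (locP z) => a s; rewrite loc_scaleE.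
by apply: frac_eq; rewrite /= scale1r mul1r.
Qed.

Lemma loc_scaleDr : right_distributive loc_scale +%R.
Proof.
move=> z w v; case: (locP z) (locP w) (locP v) => a s [b t] [c r].
rewrite (fracD b t c r) !(loc_scaleE a s) fracD.
apply: frac_eq; rewrite /= !scalerDr !scalerA.
by congr (_ *: _ + _ *: _); ring.
Qed.

Lemma loc_scaleDl v : {morph loc_scale^~ v : a b / a + b}.
Proof.
move=> z w; case: (locP z) (locP w) (locP v) => a s [b t] [c r].
rewrite (loc_ringD a b s t) (loc_scaleE _ _ c r) (loc_scaleE a s c r).
rewrite (loc_scaleE b t c r) fracD.
apply: frac_eq; rewrite /= scalerDl !scalerDr !scalerA.
by congr (_ *: _ + _ *: _); rewrite -[_ *: _]/(_ * _); ring.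
Qed.

HB.instance Definition _ := GRing.Zmodule_isLmodule.Build loc_ring AP
  loc_scaleA loc_scale1 loc_scaleDr loc_scaleDl.

Lemma fracZ (c : C) s (a : A) t :
  (frac (c : C^o) s : loc_ring) *: frac a t = frac (c *: a) (denomM s t).
Proof. exact: loc_scaleE. Qed.

Lemma loc_scaleAl (z : loc_ring) (w v : AP) : z *: (w * v) = z *: w * v.
Proof.
case: (locP z) (locP w) (locP v) => a s [b t] [c r].
rewrite (fracM b t c r) !fracZ fracM.
by apply: frac_eq; rewrite /= -scalerAl mulrA.
Qed.

Lemma loc_scaleAr (z : loc_ring) (w v : AP) : z *: (w * v) = w * (z *: v).
Proof.
case: (locP z) (locP w) (locP v) => a s [b t] [c r].
rewrite (fracM b t c r) !fracZ fracM.
by apply: frac_eq; rewrite /= -scalerAr; congr *:%R; ring.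
Qed.

End LocalizedModule.

Section Center.

Variables (R : comNzRingType) (A : algType R).

Definition central : {pred A} := fun c => `[< forall a, a * c = c * a >].

Lemma centralP c : reflect (forall a, a * c = c * a) (c \in central).
Proof. exact: asboolP. Qed.

Lemma central_subalg : subalg_closed central.
Proof.
split=> [|k u v /centralP cu /centralP cv|u v /centralP cu /centralP cv].
- by apply/centralP => a; rewrite mulr1 mul1r.
- by apply/centralP => a; rewrite mulrDr mulrDl -scalerAr -scalerAl cu cv.
- by apply/centralP => a; rewrite mulrA cu -mulrA cv mulrA.
Qed.
HB.instance Definition _ := GRing.isSubalgClosed.Build R A central
  (GRing.subalg_closed_semi central_subalg).

Record center := Central { cval : A; cvalP : cval \in central }.
HB.instance Definition _ := [isSub for cval].
HB.instance Definition _ := [Choice of center by <:].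
HB.instance Definition _ := [SubChoice_isSubAlgebra of center by <:].

Lemma center_mulC : commutative ( *%R : center -> center -> center).
Proof. by move=> c d; apply: val_inj; rewrite !rmorphM; apply/centralP/cvalP. Qed.
HB.instance Definition _ :=
  GRing.PzRing_hasCommutativeMul.Build center center_mulC.

(* A regarded as an algebra over its center. *)
Definition over_center : Type := A.
HB.instance Definition _ := GRing.NzRing.on over_center.

Definition center_scale (c : center) (a : over_center) : over_center :=
  (cval c : A) * (a : A).

Lemma center_scaleA c d a :
  center_scale c (center_scale d a) = center_scale (c * d) a.
Proof. by rewrite /center_scale mulrA. Qed.
Lemma center_scale1 : left_id 1 center_scale.
Proof. by move=> a; rewrite /center_scale mul1r. Qed.
Lemma center_scaleDr : right_distributive center_scale +%R.
Proof. by move=> c a b; rewrite /center_scale mulrDr. Qed.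
Lemma center_scaleDl a : {morph center_scale^~ a : c d / c + d}.
Proof. by move=> c d; rewrite /center_scale mulrDl. Qed.
HB.instance Definition _ := GRing.Zmodule_isLmodule.Build center over_center
  center_scaleA center_scale1 center_scaleDr center_scaleDl.

Lemma center_scaleAl (c : center) (a b : over_center) :
  c *: (a * b) = c *: a * b.
Proof. by rewrite /GRing.scale /= /center_scale mulrA. Qed.
HB.instance Definition _ :=
  GRing.Lmodule_isLalgebra.Build center over_center center_scaleAl.

Lemma center_scaleAr (c : center) (a b : over_center) :
  c *: (a * b) = a * (c *: b).
Proof.
rewrite /GRing.scale /= /center_scale !mulrA; congr (_ * _).
exact/esym/centralP/cvalP.
Qed.
HB.instance Definition _ :=
  GRing.Lalgebra_isAlgebra.Build center over_center center_scaleAr.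

Variable P : prime_idealr center.

(* A_P as an algebra over C_P, for P a prime ideal of the center C of A.      *)
Definition loc_center : Type := localization P over_center.
HB.instance Definition _ := GRing.PzRing.on loc_center.
HB.instance Definition _ :=
  GRing.Lmodule.copy loc_center (localization P over_center).

Lemma loc_center_nonzero : 1 != 0 :> loc_center.
Proof.
apply/eqP => /frac_eqP[u]; rewrite /= !scale1r scaler0 => u0.
have := den_notin u; suff -> : den u = 0 by rewrite idealr0.
by apply: val_inj; rewrite -[RHS]u0 /GRing.scale /= /center_scale mulr1.
Qed.
HB.instance Definition _ :=
  GRing.PzSemiRing_isNonZero.Build loc_center loc_center_nonzero.
HB.instance Definition _ :=
  GRing.Lmodule_isLalgebra.Build (loc_ring P) loc_center
    (@loc_scaleAl center P over_center).
HB.instance Definition _ :=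
  GRing.Lalgebra_isAlgebra.Build (loc_ring P) loc_center
    (@loc_scaleAr center P over_center).

End Center.
Arguments central {R} A.

Section TensorProduct.

Variables (R : comNzRingType) (M N : lmodType R).

(* M (x)_R N is the free abelian group on M * N modulo the subgroup generated *)
(* by the bilinearity and balancing relations.                                *)
Inductive tensor_rel : {malg int[(M * N)%type]} -> Prop :=
| TensorRelDl m m' n :
    tensor_rel (<< (m + m', n) >> - (<< (m, n) >> + << (m', n) >>))
| TensorRelDr m n n' :
    tensor_rel (<< (m, n + n') >> - (<< (m, n) >> + << (m, n') >>))
| TensorRelZ r m n :
    tensor_rel (<< (r *: m, n) >> - << (m, r *: n) >>)
| TensorRel0 : tensor_rel 0
| TensorRelB u v : tensor_rel u -> tensor_rel v -> tensor_rel (u - v).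

Definition tensor_pred : {pred {malg int[(M * N)%type]}} := fun u => `[< tensor_rel u >].

Lemma tensor_pred_closed : zmod_closed tensor_pred.
Proof.
split=> [|u v /asboolP ru /asboolP rv]; apply/asboolP; first exact: TensorRel0.
exact: TensorRelB.
Qed.
HB.instance Definition _ :=
  GRing.isZmodClosed.Build {malg int[(M * N)%type]} tensor_pred tensor_pred_closed.

Definition tensor : Type := Quotient.quot tensor_pred.
HB.instance Definition _ := GRing.Zmodule.on tensor.

Definition tens (m : M) (n : N) : tensor := \pi_tensor << (m, n) >>.

End TensorProduct.

Section Azumaya.

Variables (R : comNzRingType) (A : algType R).

Definition finitely_generated (M : lmodType R) : Prop :=
  exists (n : nat) (g : 'I_n -> M),
    forall m, exists c : 'I_n -> R, m = \sum_i c i *: g i.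

Definition projective (M : lmodType R) : Prop :=
  forall (X Y : lmodType R) (g : {linear X -> Y}) (f : {linear M -> Y}),
    (forall y, exists x, g x = y) ->
    exists h : {linear M -> X}, forall m, g (h m) = f m.

Definition faithful (M : lmodType R) : Prop :=
  forall r : R, (forall m : M, r *: m = 0) -> r = 0.

(* The canonical map from A (x)_R A^op to End_R(A), sending b (x) c to the    *)
(* endomorphism a |-> b * a * c; A^op has the same underlying R-module as A.  *)
(* It is a morphism of R-algebras, hence an isomorphism iff it is bijective.  *)
(* It is computed on a representative in the free abelian group; sandwich_pi  *)
(* shows that the choice of representative is immaterial.                     *)
Definition sandwich_free (a : A) : {malg int[(A * A)%type]} -> A :=
  mmap intr (fun bc => bc.1 * a * bc.2).
Definition sandwich (t : tensor A A) (a : A) : A := sandwich_free a (repr t).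

Lemma sandwich_freeU a b c : sandwich_free a << (b, c) >> = b * a * c.
Proof. by rewrite /sandwich_free mmapU mul1r. Qed.

Lemma sandwich_rel a u : tensor_rel u -> sandwich_free a u = 0.
Proof.
elim=> {u} [m m' n|m n n'|r m n||u v _ IHu _ IHv].
- rewrite /sandwich_free raddfB raddfD /= -/(sandwich_free a).
  by rewrite !sandwich_freeU /= !mulrDl subrr.
- rewrite /sandwich_free raddfB raddfD /= -/(sandwich_free a).
  by rewrite !sandwich_freeU /= !mulrDr subrr.
- rewrite /sandwich_free raddfB /= -/(sandwich_free a).
  by rewrite !sandwich_freeU /= -!scalerAl -scalerAr subrr.
- exact: raddf0.
- by rewrite /sandwich_free raddfB /= -!/(sandwich_free a _) IHu IHv subrr.
Qed.

Lemma sandwich_pi u a : sandwich (\pi_(tensor A A) u) a = sandwich_free a u.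
Proof.
apply/eqP; rewrite -subr_eq0 /sandwich /sandwich_free -raddfB; apply/eqP.
apply: sandwich_rel; apply/asboolP.
by have := eqxx (\pi_(tensor A A) u);
  rewrite -{1}[\pi_(tensor A A) u]reprK -Quotient.idealrBE.
Qed.

Lemma sandwich_tens b c a : sandwich (tens b c) a = b * a * c.
Proof. by rewrite sandwich_pi sandwich_freeU. Qed.

Lemma sandwichB t u a : sandwich (t - u) a = sandwich t a - sandwich u a.
Proof.
rewrite -[t]reprK -[u]reprK -raddfB !sandwich_pi.
exact: raddfB.
Qed.

(* The last two conditions say that A (x)_R A^op -> End_R(A) is bijective.    *)
Definition azumaya : Prop :=
  [/\ finitely_generated A, projective A, faithful A
    & (forall t u : tensor A A, sandwich t =1 sandwich u -> t = u) /\
      (forall f : {linear A -> A}, exists t : tensor A A, sandwich t =1 f)].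

End Azumaya.
Lemma comm_scale (R : comNzRingType) (A : algType R) (k : R) (a z : A) :
  a * z = z * a -> (k *: a) * z = z * (k *: a).
Proof. by move=> az; rewrite -scalerAl az scalerAr. Qed.

Lemma comm_mul (A : nzRingType) (a b z : A) :
  a * z = z * a -> b * z = z * b -> (a * b) * z = z * (a * b).
Proof. by move=> az bz; rewrite -mulrA bz !mulrA az. Qed.

Section QuantumWeyl.

Variables (R : comNzRingType) (q : R).

(* The free associative algebra R<x, y>: the monoid algebra of the free       *)
(* monoid on two letters, true standing for x and false for y.                *)
Definition free_alg : Type := {malg R[{fmonom bool}]}.
HB.instance Definition _ := GRing.Lalgebra.on free_alg.

Lemma free_alg_scaleAr (k : R) (u v : free_alg) : k *: (u * v) = u * (k *: v).
Proof.
have comm (w : free_alg) : (k%:MP : free_alg) * w = w * k%:MP.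
  rewrite malgM_def fgmulUg [RHS]fgmulgU; apply: eq_bigr => m _.
  by rewrite mul1m mulm1 mulrC.
by rewrite -!(mul_malgC k) mulrA comm mulrA.
Qed.
HB.instance Definition _ :=
  GRing.Lalgebra_isAlgebra.Build R free_alg free_alg_scaleAr.

Definition free_x : free_alg := << fmu true >>.
Definition free_y : free_alg := << fmu false >>.

Definition qweyl_relator : free_alg :=
  free_x * free_y - q *: (free_y * free_x) - 1.

Definition qweyl_ideal : {pred free_alg} := fun u =>
  `[< exists l : seq (free_alg * free_alg),
        u = \sum_(ab <- l) ab.1 * qweyl_relator * ab.2 >].

Lemma qweyl_ideal_closed : zmod_closed qweyl_ideal.
Proof.
split=> [|u v /asboolP[l ->] /asboolP[l' ->]]; apply/asboolP.
  by exists [::]; rewrite big_nil.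
exists (l ++ [seq (- ab.1, ab.2) | ab <- l']).
rewrite big_cat big_map /= -sumrN; congr (_ + _).
by apply: eq_bigr => ab _; rewrite !mulNr.
Qed.
HB.instance Definition _ :=
  GRing.isZmodClosed.Build free_alg qweyl_ideal qweyl_ideal_closed.

Lemma qweyl_idealMl u v : v \in qweyl_ideal -> u * v \in qweyl_ideal.
Proof.
move=> /asboolP[l ->]; apply/asboolP; exists [seq (u * ab.1, ab.2) | ab <- l].
by rewrite big_map mulr_sumr; apply: eq_bigr => ab _; rewrite !mulrA.
Qed.

Lemma qweyl_idealMr u v : u \in qweyl_ideal -> u * v \in qweyl_ideal.
Proof.
move=> /asboolP[l ->]; apply/asboolP; exists [seq (ab.1, ab.2 * v) | ab <- l].
by rewrite big_map mulr_suml; apply: eq_bigr => ab _; rewrite -[LHS]mulrA.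
Qed.

Lemma qweyl_relator_in : qweyl_relator \in qweyl_ideal.
Proof.
by apply/asboolP; exists [:: (1, 1)]; rewrite big_seq1 mul1r mulr1.
Qed.

(* The ideal is proper: R<x, y> acts on R[X] with y acting as multiplication  *)
(* by X and x as the q-derivative, and the relator acts as zero.              *)
Definition qnat n : R := \sum_(i < n) q ^+ i.

Definition qderiv (f : {poly R}) : {poly R} :=
  \poly_(i < size f) (qnat i.+1 * f`_i.+1).

Lemma coef_qderiv f i : (qderiv f)`_i = qnat i.+1 * f`_i.+1.
Proof.
rewrite coef_poly; case: ltnP => // le.
by rewrite nth_default ?mulr0 // ltnW.
Qed.

Definition letter_act (b : bool) (f : {poly R}) : {poly R} :=
  if b then qderiv f else 'X * f.

Lemma letter_act_linear b : linear (letter_act b).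
Proof.
case: b => k f g /=; last by rewrite mulrDr -scalerAr.
apply/polyP => i.
by rewrite coefD coefZ !coef_qderiv coefD coefZ mulrDr mulrCA.
Qed.

Definition word_act (w : {fmonom bool}) (f : {poly R}) : {poly R} :=
  foldr letter_act f w.

Lemma word_act_linear w : linear (word_act w).
Proof.
rewrite /word_act; elim: (w : seq bool) => //= b s IH k f g.
by rewrite IH letter_act_linear.
Qed.
HB.instance Definition _ w := GRing.isLinear.Build R {poly R} {poly R} _
  (word_act w) (word_act_linear w).

Definition free_act (u : free_alg) (f : {poly R}) : {poly R} :=
  mmap (@polyC R) (fun w => word_act w f) u.

Lemma free_actU c w f : free_act << c *g w >> f = c *: word_act w f.
Proof. by rewrite /free_act mmapU mul_polyC. Qed.

Lemma free_actE u f : free_act u f = \sum_(w <- msupp u) u@_w *: word_act w f.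
Proof.
by rewrite /free_act mmapE; apply: eq_bigr => w _; rewrite mul_polyC.
Qed.

Lemma free_actM u v f : free_act (u * v) f = free_act u (free_act v f).
Proof.
rewrite malgME [LHS]raddf_sum [RHS]free_actE.
apply: eq_bigr => w _; rewrite raddf_sum free_actE linear_sum scaler_sumr.
apply: eq_bigr => w' _; rewrite linearZ /= scalerA.
by rewrite [LHS]free_actU /word_act fmM foldr_cat.
Qed.

Lemma free_actB u v f : free_act (u - v) f = free_act u f - free_act v f.
Proof. exact: raddfB. Qed.

Lemma free_actZ k u f : free_act (k *: u) f = k *: free_act u f.
Proof.
by rewrite -(mul_malgC k u) free_actM free_actU /word_act fm1.
Qed.

Lemma free_act1 f : free_act 1 f = f.
Proof. by rewrite free_actU scale1r /word_act fm1. Qed.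

Lemma free_act_x f : free_act free_x f = qderiv f.
Proof. by rewrite free_actU scale1r /word_act fmU. Qed.

Lemma free_act_y f : free_act free_y f = 'X * f.
Proof. by rewrite free_actU scale1r /word_act fmU. Qed.

Lemma free_act_comb u v w f :
  free_act (u * v - q *: (v * u) - w) f =
  free_act u (free_act v f) - q *: free_act v (free_act u f) - free_act w f.
Proof.
transitivity (free_act (u * v - q *: (v * u)) f - free_act w f).
  exact: free_actB.
congr (_ - _).
transitivity (free_act (u * v) f - free_act (q *: (v * u)) f).
  exact: free_actB.
congr (_ - _); first exact: free_actM.
by rewrite (free_actZ q (v * u)); congr (_ *: _); apply: free_actM.
Qed.

Lemma free_act_relator f : free_act qweyl_relator f = 0.
Proof.
transitivity (qderiv ('X * f) - q *: ('X * qderiv f) - f).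
  transitivity (free_act free_x (free_act free_y f) -
      q *: free_act free_y (free_act free_x f) - free_act 1 f).
    exact: free_act_comb.
  by congr (_ - _ *: _ - _);
    [rewrite free_act_y free_act_x|rewrite free_act_x free_act_y|exact: free_act1].
apply/polyP => i; rewrite !(coefB, coefZ, coef0) coef_qderiv !coefXM coef_qderiv.
case: i => [|i] /=.
  by rewrite mulr0 subr0 /qnat big_ord1 expr0 mul1r subrr.
rewrite mulrA -mulrBl /qnat big_ord_recl expr0 mulr_sumr.
under eq_bigr => j _ do rewrite /bump /= exprS.
by rewrite addrK mul1r subrr.
Qed.

Lemma free_act0 u : free_act u 0 = 0.
Proof. by rewrite free_actE big1 // => w _; rewrite linear0 scaler0. Qed.

Lemma qweyl_ideal_proper : 1 \notin qweyl_ideal.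
Proof.
apply/negP => /asboolP[l e].
have /eqP[] : (1 : {poly R}) != 0 by exact: oner_neq0.
transitivity (free_act 1 1); first by rewrite free_act1.
rewrite e [LHS]raddf_sum big1 // => -[a b] _ /=.
transitivity (free_act (a * qweyl_relator) (free_act b 1)).
  exact: free_actM.
transitivity (free_act a (free_act qweyl_relator (free_act b 1))).
  exact: free_actM.
by rewrite free_act_relator free_act0.
Qed.

Definition qweyl : Type := Quotient.quot qweyl_ideal.
HB.instance Definition _ := GRing.Zmodule.on qweyl.

Definition qweyl_pi : free_alg -> qweyl := \pi_qweyl.

Lemma qweyl_piP u v : qweyl_pi u = qweyl_pi v <-> u - v \in qweyl_ideal.
Proof.
have -> : (u - v \in qweyl_ideal) = (qweyl_pi u == qweyl_pi v).
  exact: Quotient.idealrBE.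
by split=> /eqP.
Qed.

Lemma qweyl_piK z : qweyl_pi (repr z) = z.
Proof. exact: reprK. Qed.

Lemma qweyl_piD u v : qweyl_pi (u + v) = qweyl_pi u + qweyl_pi v.
Proof. exact: raddfD. Qed.

Definition qweyl_one : qweyl := qweyl_pi 1.
Definition qweyl_mul (z w : qweyl) : qweyl := qweyl_pi (repr z * repr w).
Definition qweyl_scale (k : R) (z : qweyl) : qweyl := qweyl_pi (k *: repr z).

Lemma qweyl_repr_pi u : repr (qweyl_pi u) - u \in qweyl_ideal.
Proof. by apply/qweyl_piP; rewrite qweyl_piK. Qed.

Lemma qweyl_piM u v : qweyl_pi (u * v) = qweyl_mul (qweyl_pi u) (qweyl_pi v).
Proof.
apply/esym/qweyl_piP; set u' := repr _; set v' := repr _.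
have -> : u' * v' - u * v = (u' - u) * v' + u * (v' - v).
  by rewrite mulrBl mulrBr addrA subrK.
apply: rpredD; first exact/qweyl_idealMr/qweyl_repr_pi.
exact/qweyl_idealMl/qweyl_repr_pi.
Qed.

Lemma qweyl_piZ k u : qweyl_pi (k *: u) = qweyl_scale k (qweyl_pi u).
Proof.
apply/esym/qweyl_piP; rewrite -scalerBr -mul_malgC.
exact/qweyl_idealMl/qweyl_repr_pi.
Qed.

Variant qweyl_spec : qweyl -> Type := QWeylSpec u : qweyl_spec (qweyl_pi u).
Lemma qweylP z : qweyl_spec z.
Proof. by rewrite -[z]qweyl_piK; apply: QWeylSpec. Qed.

Lemma qweyl_mulA : associative qweyl_mul.
Proof.
by move=> z w v; case: (qweylP z) (qweylP w) (qweylP v) => a [b] [c];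
  rewrite -!qweyl_piM mulrA.
Qed.
Lemma qweyl_mul1 : left_id qweyl_one qweyl_mul.
Proof. by move=> z; case: (qweylP z) => a; rewrite -qweyl_piM mul1r. Qed.
Lemma qweyl_mul1r : right_id qweyl_one qweyl_mul.
Proof. by move=> z; case: (qweylP z) => a; rewrite -qweyl_piM mulr1. Qed.
Lemma qweyl_mulDl : left_distributive qweyl_mul +%R.
Proof.
by move=> z w v; case: (qweylP z) (qweylP w) (qweylP v) => a [b] [c];
  rewrite -qweyl_piD -!qweyl_piM mulrDl qweyl_piD.
Qed.
Lemma qweyl_mulDr : right_distributive qweyl_mul +%R.
Proof.
by move=> z w v; case: (qweylP z) (qweylP w) (qweylP v) => a [b] [c];
  rewrite -qweyl_piD -!qweyl_piM mulrDr qweyl_piD.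
Qed.
Lemma qweyl_nonzero : qweyl_one != 0.
Proof.
apply/eqP => e; have /qweyl_piP : qweyl_pi 1 = qweyl_pi 0.
  by rewrite [LHS]e [RHS]raddf0.
by rewrite subr0; apply/negP/qweyl_ideal_proper.
Qed.
HB.instance Definition _ := GRing.Zmodule_isNzRing.Build qweyl
  qweyl_mulA qweyl_mul1 qweyl_mul1r qweyl_mulDl qweyl_mulDr qweyl_nonzero.

Lemma qweyl_scaleA k l z :
  qweyl_scale k (qweyl_scale l z) = qweyl_scale (k * l) z.
Proof. by case: (qweylP z) => a; rewrite -!qweyl_piZ scalerA. Qed.
Lemma qweyl_scale1 : left_id 1 qweyl_scale.
Proof. by move=> z; case: (qweylP z) => a; rewrite -qweyl_piZ scale1r. Qed.
Lemma qweyl_scaleDr : right_distributive qweyl_scale +%R.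
Proof.
by move=> k z w; case: (qweylP z) (qweylP w) => a [b];
  rewrite -qweyl_piD -!qweyl_piZ scalerDr qweyl_piD.
Qed.
Lemma qweyl_scaleDl z : {morph qweyl_scale^~ z : k l / k + l}.
Proof.
by move=> k l; case: (qweylP z) => a; rewrite -!qweyl_piZ scalerDl qweyl_piD.
Qed.
HB.instance Definition _ := GRing.Zmodule_isLmodule.Build R qweyl
  qweyl_scaleA qweyl_scale1 qweyl_scaleDr qweyl_scaleDl.

Lemma qweyl_pi_mul u v : qweyl_pi (u * v) = qweyl_pi u * qweyl_pi v.
Proof. exact: qweyl_piM. Qed.

Lemma qweyl_pi_scale k u : qweyl_pi (k *: u) = k *: qweyl_pi u.
Proof. exact: qweyl_piZ. Qed.

Lemma qweyl_scaleAl (k : R) (z w : qweyl) : k *: (z * w) = k *: z * w.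
Proof.
case: (qweylP z) (qweylP w) => a [b].
by rewrite -(qweyl_pi_mul a b) -!qweyl_pi_scale -qweyl_pi_mul -scalerAl.
Qed.
HB.instance Definition _ := GRing.Lmodule_isLalgebra.Build R qweyl qweyl_scaleAl.

Lemma qweyl_scaleAr (k : R) (z w : qweyl) : k *: (z * w) = z * (k *: w).
Proof.
case: (qweylP z) (qweylP w) => a [b].
by rewrite -(qweyl_pi_mul a b) -!qweyl_pi_scale -qweyl_pi_mul -scalerAr.
Qed.
HB.instance Definition _ := GRing.Lalgebra_isAlgebra.Build R qweyl qweyl_scaleAr.

Definition qweyl_x : qweyl := qweyl_pi free_x.
Definition qweyl_y : qweyl := qweyl_pi free_y.

Lemma qweyl_rel : qweyl_x * qweyl_y - q *: (qweyl_y * qweyl_x) - 1 = 0.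
Proof.
rewrite /qweyl_x /qweyl_y -!qweyl_pi_mul -qweyl_pi_scale.
have pi0 : qweyl_pi qweyl_relator = 0.
  transitivity (qweyl_pi 0); last exact: raddf0.
  by apply/qweyl_piP; rewrite subr0; apply: qweyl_relator_in.
by rewrite -[RHS]pi0 /qweyl_pi !raddfB.
Qed.

Lemma qweyl_pi_sum (I : Type) (r : seq I) (F : I -> free_alg) :
  qweyl_pi (\sum_(i <- r) F i) = \sum_(i <- r) qweyl_pi (F i).
Proof. exact: raddf_sum. Qed.

Lemma qweyl_centralP (z : qweyl) :
  qweyl_x * z = z * qweyl_x -> qweyl_y * z = z * qweyl_y -> z \in central qweyl.
Proof.
move=> cx cy; apply/centralP => w; case: (qweylP w) => u.
rewrite (monalgE u) qweyl_pi_sum mulr_suml mulr_sumr.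
apply: eq_bigr => m _.
have -> : qweyl_pi << u@_m *g m >> = u@_m *: qweyl_pi << m >>.
  rewrite -qweyl_pi_scale; congr qweyl_pi.
  by rewrite -mul_malgC malgM_def fgmulUU mulr1 mul1m.
apply: comm_scale; rewrite -[m]fmK.
elim: (m : seq bool) => [|b s IH].
  by rewrite -fmoneE; apply: etrans (mul1r z) (esym (mulr1 z)).
have -> : qweyl_pi << FMonom (b :: s) >> =
    (if b then qweyl_x else qweyl_y) * qweyl_pi << FMonom s >>.
  have -> : FMonom (b :: s) = mmul (fmu b) (FMonom s).
    by apply/eqP; rewrite fmP fmM fmU.
  have -> : << mmul (fmu b) (FMonom s) >> =
      (<< fmu b >> : free_alg) * (<< FMonom s >> : free_alg).
    by rewrite malgM_def fgmulUU mulr1.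
  by case: b; apply: qweyl_pi_mul.
case: b; apply: comm_mul; [exact: cx|exact: IH|exact: cy|exact: IH].
Qed.

End QuantumWeyl.
Section QuantumWeylPowers.

Variables (R : comNzRingType) (q : R) (A : algType R) (x y : A).
Hypothesis xyE : x * y = q *: (y * x) + 1.

Lemma qcomm_xn_y n :
  x ^+ n.+1 * y = q ^+ n.+1 *: (y * x ^+ n.+1) + qnat q n.+1 *: x ^+ n.
Proof.
elim: n => [|n IH].
  by rewrite !expr1 expr0 xyE /qnat big_ord1 expr0 scale1r.
rewrite [in LHS]exprS -mulrA IH mulrDr -!scalerAr (mulrA x y) xyE mulrDl mul1r.
rewrite -scalerAl -mulrA -!exprS scalerDr scalerA -exprSr -addrA -scalerDl.
by rewrite /qnat [in RHS]big_ord_recr /= [q ^+ _ + _]addrC.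
Qed.

Lemma qcomm_x_yn n :
  x * y ^+ n.+1 = q ^+ n.+1 *: (y ^+ n.+1 * x) + qnat q n.+1 *: y ^+ n.
Proof.
elim: n => [|n IH].
  by rewrite !expr1 expr0 xyE /qnat big_ord1 expr0 scale1r.
rewrite [in LHS]exprSr mulrA IH mulrDl -!scalerAl -(mulrA _ x y) xyE mulrDr mulr1.
rewrite -scalerAr mulrA -!exprSr scalerDr scalerA -exprSr -addrA -scalerDl.
by rewrite /qnat [in RHS]big_ord_recr /= [q ^+ _ + _]addrC.
Qed.

Lemma qcomm_central n : (0 < n)%N -> q ^+ n = 1 -> qnat q n = 0 ->
  x ^+ n * y = y * x ^+ n /\ x * y ^+ n = y ^+ n * x.
Proof.
case: n => // n _ qn1 qn0; split.
  by rewrite qcomm_xn_y qn1 qn0 scale0r addr0 scale1r.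
by rewrite qcomm_x_yn qn1 qn0 scale0r addr0 scale1r.
Qed.

End QuantumWeylPowers.

(* Z[rho] = Z[X] / (1 + X + ... + X^(p-1)). For p prime the modulus is monic  *)
(* of positive degree, so that {poly %/ _} is the quotient by it.             *)
Definition rho_poly (p : nat) : {poly int} := \sum_(i < p) 'X^i.
Definition Zrho (p : nat) : Type := {poly %/ rho_poly p}.
HB.instance Definition _ p := GRing.ComNzRing.on (Zrho p).

Definition rho p : Zrho p := in_qpoly (rho_poly p) 'X.
Definition eta p : Zrho p := rho p - 1.

Lemma rho_poly_monic p : (0 < p)%N -> rho_poly p \is monic /\ size (rho_poly p) = p.
Proof.
case: p => // p _; have -> : rho_poly p.+1 = \poly_(i < p.+1) 1.
  by rewrite poly_def; apply: eq_bigr => i _; rewrite scale1r.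
split; last by rewrite size_poly_eq // oner_neq0.
by rewrite monicE lead_coef_poly // oner_neq0.
Qed.

Lemma rho_sum p : prime p -> \sum_(i < p) rho p ^+ i = 0.
Proof.
move=> pr_p; have [mon sz] := rho_poly_monic (prime_gt0 pr_p).
transitivity (in_qpoly (rho_poly p) (rho_poly p) : Zrho p).
  rewrite [in RHS]/rho_poly rmorph_sum; apply: eq_bigr => i _.
  by rewrite [RHS]rmorphXn.
apply: val_inj => /=.
by rewrite /mk_monic sz prime_gt1 // mon /= Pdiv.RingMonic.rmodpp.
Qed.

Lemma rho_exp p : prime p -> rho p ^+ p = 1.
Proof.
move=> pr_p; apply/eqP.
by rewrite -subr_eq0 subrX1 [X in _ * X]rho_sum // mulr0.
Qed.

Definition B (p : nat) : algType (Zrho p) := qweyl (rho p).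

Definition x p : B p := qweyl_x (rho p).
Definition y p : B p := qweyl_y (rho p).

Lemma xyE p : x p * y p = rho p *: (y p * x p) + 1.
Proof.
by apply/eqP; rewrite -subr_eq0 opprD addrA; apply/eqP/qweyl_rel.
Qed.

Lemma xp_central p : prime p -> x p ^+ p \in central (B p).
Proof.
move=> pr_p; have [xpy _] :=
  qcomm_central (xyE p) (prime_gt0 pr_p) (rho_exp pr_p) (rho_sum pr_p).
apply: qweyl_centralP; last exact/esym/xpy.
exact: (etrans (esym (exprS _ _)) (exprSr _ _)).
Qed.

Lemma yp_central p : prime p -> y p ^+ p \in central (B p).
Proof.
move=> pr_p; have [_ xyp] :=
  qcomm_central (xyE p) (prime_gt0 pr_p) (rho_exp pr_p) (rho_sum pr_p).
apply: qweyl_centralP; first exact: xyp.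
exact: (etrans (esym (exprS _ _)) (exprSr _ _)).
Qed.

Definition C (p : nat) : comAlgType (Zrho p) := center (B p).
Definition s p (pr_p : prime p) : C p := Central (xp_central pr_p).
Definition t p (pr_p : prime p) : C p := Central (yp_central pr_p).

(* Main.v *)
(* The element z = xy - yx = 1 + eta yx satisfies xz = rho zx and zy = rho yz,*)
(* and the q-binomial formula gives z^p = 1 + s t eta^p.                      *)
(*   Since [x, y^a x^b] = [a]_q y^(a-1) z x^b, the operators z^-1 ad x and    *)
(* z^-1 ad y act, once z^p is invertible, as q-derivatives in y and in x. The *)
(* q-integers [1]_q, ..., [p-1]_q are units, so the (p-1)-fold iterates of    *)
(* these derivatives extract the coefficient of y^(p-1) x^(p-1), and all      *)
(* coordinates on the basis y^i x^j over the center are given by elements of  *)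
(* the enveloping algebra; this forces B_P to be Azumaya.                     *)
(*   Conversely, z is normal, so every element of the enveloping algebra      *)
(* preserves z B_P. If B_P is Azumaya, the coordinate of index (0, 0), which  *)
(* maps both z and 1 to 1, is such an element, so z is invertible in B_P, and *)
(* taking coordinates makes z^p invertible in C_P.                            *)

From HB Require Import structures.
Require Import Defs.
From mathcomp Require Import all_boot all_algebra.
From mathcomp Require Import generic_quotient boolp finmap monalg ring.

Set Implicit Arguments.
Unset Strict Implicit.
Unset Printing Implicit Defensive.

Import GRing.Theory.
Local Open Scope ring_scope.
Local Open Scope quotient_scope.

(** Put [z] = xy - yx = 1 + (q - 1)yx with q = [rho p]. It commutes with [x] and [y] up to powers of
    q, so z^p is central, and the vanishing of the Gaussian binomials of p gives z^p = 1 + st eta^p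
    for odd p ([qcomm_expp]). The claim becomes: B_P is Azumaya exactly when z^p lies outside P.
    Commutators with [x] and [y] are, up to [z], q-derivatives. Iterating each p - 1 times reads off
    a coordinate on the monomials y^i x^j, i, j < p, up to a power of z^p ([qcoord_monomial]). When
    z^p is outside P, these coordinates form a dual basis of B_P made of two-sided multiplications,
    which yields every Azumaya condition ([azumaya_dual_basis], [azumaya_loc_center]). Conversely,
    over an Azumaya B_P the coordinate of index (0, 0) is a two-sided multiplication. It preserves
    the ideal generated by the normal element [z] and sends [z] to 1, so [z] is invertible and z^p
    is outside P ([azumaya_normal_power_notin]). Two facts are specific to B: the monomials span it
    ([qweyl_ind]) and [z] is regular ([qcomm_lreg]). Both come from the left regular representation
    on polynomials. *)

(** * Calculus of pure tensors *)

Section Tensor.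

Variables (R : comNzRingType) (M N : lmodType R).
Local Notation T := (tensor M N).

Lemma tensor_pi_eq (v w : {malg int[(M * N)%type]}) :
  tensor_rel (v - w) -> \pi_T v = \pi_T w.
Proof.
move=> rvw; apply/eqP; rewrite -Quotient.idealrBE; exact/asboolP.
Qed.

Lemma tensDl (m m' : M) (n : N) : tens (m + m') n = tens m n + tens m' n.
Proof. by rewrite /tens -raddfD; apply/tensor_pi_eq/TensorRelDl. Qed.

Lemma tensDr (m : M) (n n' : N) : tens m (n + n') = tens m n + tens m n'.
Proof. by rewrite /tens -raddfD; apply/tensor_pi_eq/TensorRelDr. Qed.

Lemma tensZ (r : R) (m : M) (n : N) : tens (r *: m) n = tens m (r *: n).
Proof. exact/tensor_pi_eq/TensorRelZ. Qed.

Lemma tens0l (n : N) : tens (0 : M) n = 0.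
Proof. by apply: (addrI (tens 0 n)); rewrite -tensDl !addr0. Qed.

Lemma tens0r (m : M) : tens m (0 : N) = 0.
Proof. by apply: (addrI (tens m 0)); rewrite -tensDr !addr0. Qed.

Lemma tens_suml (I : Type) (r : seq I) (F : I -> M) (n : N) :
  tens (\sum_(i <- r) F i) n = \sum_(i <- r) tens (F i) n.
Proof.
exact: (big_morph (fun m => tens m n) (fun a b => tensDl a b n) (tens0l n)).
Qed.

Lemma tens_sumr (I : Type) (r : seq I) (F : I -> N) (m : M) :
  tens m (\sum_(i <- r) F i) = \sum_(i <- r) tens m (F i).
Proof. exact: (big_morph (tens m) (tensDr m) (tens0r m)). Qed.

Lemma tensNl (m : M) (n : N) : tens (- m) n = - tens m n.
Proof. by apply/eqP; rewrite -addr_eq0 -tensDl addNr tens0l. Qed.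

Lemma tensMnl (m : M) (n : N) k : tens (m *+ k) n = tens m n *+ k.
Proof. by elim: k => [|k IH]; rewrite ?mulr0n ?tens0l // !mulrS tensDl IH. Qed.

(** The integer coefficients of the free abelian group are absorbed into the left factors. *)
Lemma tensor_sum (v : T) :
  exists l : seq (M * N), v = \sum_(c <- l) tens c.1 c.2.
Proof.
rewrite -[v]reprK; move: (repr v) => w; rewrite (monalgE w).
exists [seq (c.1 *~ w@_c, c.2) | c <- msupp w].
rewrite big_map raddf_sum; apply: eq_bigr => -[m n] _ /=.
have -> : << w@_(m, n) *g (m, n) >> =
    << (m, n) >> *~ w@_(m, n) :> {malg int[(M * N)%type]}.
  apply/malgP => k; rewrite (raddfMz (mcoeff k)) /= !mcoeffU.
  by case: (_ == k); rewrite ?mul0rz ?intz.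
rewrite raddfMz; case: (w@_(m, n)) => k; first by rewrite -!pmulrn tensMnl.
by rewrite !NegzE !mulrNz -!pmulrn tensNl tensMnl.
Qed.

End Tensor.

(** * Two-sided multiplication operators *)

Section SandwichOperators.

Variable A : nzRingType.

(** The list of pairs stands for an element of the enveloping algebra, so that no quotient has to be
    handled. *)
Definition sandwich_op (F : A -> A) : Prop :=
  exists l : seq (A * A), forall a, F a = \sum_(c <- l) c.1 * a * c.2.

Lemma eq_sandwich_op (F G : A -> A) :
  F =1 G -> sandwich_op F -> sandwich_op G.
Proof. by move=> FG [l Fl]; exists l => a; rewrite -FG. Qed.

Lemma sandwich_op_mul (b c : A) : sandwich_op (fun a => b * a * c).
Proof. by exists [:: (b, c)] => a; rewrite big_seq1. Qed.

Lemma sandwich_op_id : sandwich_op id.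
Proof. by exists [:: (1, 1)] => a; rewrite big_seq1 mul1r mulr1. Qed.

Lemma sandwich_opB (F G : A -> A) :
  sandwich_op F -> sandwich_op G -> sandwich_op (fun a => F a - G a).
Proof.
move=> [l Fl] [m Gm]; exists (l ++ [seq (- c.1, c.2) | c <- m]) => a.
rewrite big_cat big_map Fl Gm -sumrN; congr (_ + _).
by apply: eq_bigr => c _; rewrite !mulNr.
Qed.

Lemma sandwich_op_comp (F G : A -> A) :
  sandwich_op F -> sandwich_op G -> sandwich_op (F \o G).
Proof.
move=> [l Fl] [m Gm].
exists [seq (c.1 * d.1, d.2 * c.2) | c <- l, d <- m] => a.
rewrite big_allpairs_dep /= Fl; apply: eq_bigr => c _.
rewrite Gm mulr_sumr mulr_suml; apply: eq_bigr => d _ /=.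
by rewrite !mulrA.
Qed.

Lemma sandwich_op_iter (F : A -> A) n :
  sandwich_op F -> sandwich_op (iter n F).
Proof.
move=> Fop; elim: n => [|n IH]; first exact: sandwich_op_id.
exact: sandwich_op_comp.
Qed.

Lemma sandwich_opD (F : A -> A) : sandwich_op F -> {morph F : a b / a + b}.
Proof.
move=> [l Fl] a b; rewrite !Fl -big_split; apply: eq_bigr => c _ /=.
by rewrite mulrDr mulrDl.
Qed.

Lemma sandwich_op_centralMl (F : A -> A) c a : sandwich_op F ->
  (forall b, b * c = c * b) -> F (c * a) = c * F a.
Proof.
move=> [l Fl] cc; rewrite !Fl mulr_sumr; apply: eq_bigr => d _.
by rewrite !mulrA cc.
Qed.

End SandwichOperators.

Lemma sandwich_opZ (R : comNzRingType) (A : algType R) (F : A -> A) k a :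
  sandwich_op F -> F (k *: a) = k *: F a.
Proof.
move=> [l Fl]; rewrite !Fl scaler_sumr; apply: eq_bigr => c _.
by rewrite -scalerAr -scalerAl.
Qed.

Lemma sandwich_sum (R : comNzRingType) (A : algType R) (a : A) (J : Type)
    (r : seq J) (G : J -> tensor A A) :
  sandwich (\sum_(j <- r) G j) a = \sum_(j <- r) sandwich (G j) a.
Proof.
have sw0 : sandwich (0 : tensor A A) a = 0.
  by rewrite -[X in sandwich X](subrr 0) sandwichB subrr.
apply: (big_morph (fun v => sandwich v a)) => // v w.
by rewrite -[w in LHS]opprK sandwichB -[- w]sub0r sandwichB sw0 sub0r opprK.
Qed.

(** * Azumaya algebras from a dual basis of sandwich operators *)

Section AzumayaCriterion.

Variables (R : comNzRingType) (A : algType R).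
Variables (I : finType) (g : I -> A) (F : I -> A -> A).
Hypothesis Fop : forall i, sandwich_op (F i).
Hypothesis Fscalar : forall i a, exists r : R, F i a = r%:A.
Hypothesis Fdual : forall a, a = \sum_i F i a * g i.
Hypothesis scalar_inj : forall r : R, r%:A = 0 :> A -> r = 0.

Let phi i a : R := sval (cid (Fscalar i a)).
Let phiE i a : (phi i a)%:A = F i a.
Proof. by rewrite /phi; case: cid. Qed.
Let phi_eq i a r : F i a = r%:A -> phi i a = r.
Proof.
move=> Fr; apply/eqP; rewrite -subr_eq0; apply/eqP/scalar_inj.
by rewrite scalerBl phiE Fr subrr.
Qed.
Let phi_linear i k a b : phi i (k *: a + b) = k * phi i a + phi i b.
Proof.
apply: phi_eq; rewrite (sandwich_opD (Fop i)) (sandwich_opZ _ _ (Fop i)).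
by rewrite -!phiE scalerDl scalerA.
Qed.
Let expand a : a = \sum_i phi i a *: g i.
Proof.
rewrite [LHS]Fdual; apply: eq_bigr => i _.
by rewrite -phiE -scalerAl mul1r.
Qed.

(* The functionals [F i] being sandwich operators, they can be moved across a *)
(* tensor: [\sum_j a_j (x) b_j] equals                                        *)
(* [\sum_i g_i (x) \sum_j F_i(a_j) b_j], and the right factors are made of    *)
(* values of the endomorphism induced by the tensor.                          *)
Theorem azumaya_dual_basis : azumaya A.
Proof.
split.
- exists #|I|, (fun j => g (enum_val j)) => a.
  exists (fun j => phi (enum_val j) a); rewrite [LHS]expand.
  by rewrite (eq_bigl (fun i => i \in I)) // big_enum_val.
- move=> X Y s f surj_s.
  (* Preimages of the [f (g i)] are chosen and extended by the coordinates. *)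
  pose h a := \sum_i phi i a *: sval (cid (surj_s (f (g i)))).
  have h_lin : linear h.
    move=> k a b; rewrite /h scaler_sumr -big_split; apply: eq_bigr => i _ /=.
    by rewrite phi_linear scalerDl scalerA.
  pose hL := GRing.isLinear.Build R A X *:%R h h_lin.
  pose hh : {linear A -> X} := HB.pack h hL.
  exists hh => a /=; rewrite /h linear_sum [in RHS](expand a) linear_sum.
  by apply: eq_bigr => i _; rewrite !linearZ /=; case: cid => ? /= ->.
- by move=> r r0; apply: scalar_inj; apply: r0.
split=> [v w vw|f]; last first.
  have [l lE] : exists l : I -> seq (A * A),
      forall i a, F i a = \sum_(c <- l i) c.1 * a * c.2.
    by exists (fun i => sval (cid (Fop i))) => i; case: cid.
  (* This tensor acts as the sum of the [F i a * f (g i)], which is [f a] because each [F i a] is a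
     scalar. *)
  exists (\sum_i \sum_(c <- l i) tens c.1 (c.2 * f (g i))) => a.
  rewrite sandwich_sum [in RHS](expand a) linear_sum; apply: eq_bigr => i _.
  rewrite sandwich_sum linearZ /= -[f (g i) in RHS]mul1r scalerAl phiE lE.
  rewrite mulr_suml.
  by apply: eq_bigr => c _; rewrite sandwich_tens !mulrA.
apply/eqP; rewrite -subr_eq0; apply/eqP.
have {vw} : sandwich (v - w) =1 fun=> 0 by move=> a; rewrite sandwichB vw subrr.
case: (tensor_sum (v - w)) => l ->; move=> {v w} l0.
have {}l0 a : \sum_(c <- l) c.1 * a * c.2 = 0.
  rewrite -[RHS](l0 a) sandwich_sum.
  by apply: eq_bigr => c _; rewrite sandwich_tens.
have -> : \sum_(c <- l) tens c.1 c.2 =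
    \sum_i tens (g i) (\sum_(c <- l) phi i c.1 *: c.2).
  under [RHS]eq_bigr do rewrite tens_sumr.
  rewrite exchange_big; apply: eq_bigr => c _ /=.
  rewrite [in LHS](expand c.1) tens_suml; apply: eq_bigr => i _.
  by rewrite tensZ.
rewrite big1 // => i _; rewrite [X in tens _ X](_ : _ = 0) ?tens0r //.
have [m mE] := Fop i.
transitivity (\sum_(c <- l) \sum_(d <- m) d.1 * c.1 * d.2 * c.2).
  apply: eq_bigr => c _.
  by rewrite -[c.2 in LHS]mul1r scalerAl phiE mE mulr_suml.
rewrite exchange_big big1 // => d _ /=.
under eq_bigr do rewrite -!mulrA.
rewrite -mulr_sumr; under eq_bigr do rewrite mulrA.
by rewrite l0 mulr0.
Qed.

End AzumayaCriterion.

(** * The criterion after localization at a prime of the center *)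

Section LocalizedCriterion.

Variables (R : comNzRingType) (A : algType R) (P : prime_idealr (center A)).
Local Notation AP := (loc_center P).
Local Notation fr a s := (Defs.frac (P := P) (A := over_center A) a s : AP).

Lemma fr_sum (J : Type) (r : seq J) (G : J -> A) s :
  fr (\sum_(j <- r) G j) s = \sum_(j <- r) fr (G j) s.
Proof.
apply: (big_morph (fun a => fr a s)) => [a b|].
  rewrite [RHS]fracD; apply: frac_eq => /=.
  by rewrite -scalerDr scalerA.
by apply: frac_eq; rewrite /= !scaler0.
Qed.

Lemma frM a s b t : fr a s * fr b t = fr (a * b) (denomM s t).
Proof. exact: fracM. Qed.

Lemma scale_fr1 (c : center A) s :
  (Defs.frac (P := P) (A := (center A)^o) c s : loc_ring P)%:A = fr (cval c) s.
Proof.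
rewrite [LHS]fracZ; apply: frac_eq; rewrite /= mulr1; congr (_ *: _).
exact: mulr1.
Qed.

(** [U] becomes invertible over C_P, and dividing the operators [F i] by it gives a dual basis of
    A_P. *)
Lemma azumaya_loc_center (I : finType) (g : I -> A) (F : I -> A -> A)
    (U : center A) :
  (forall i, sandwich_op (F i)) -> (forall i a, F i a \in central A) ->
  (forall a, cval U * a = \sum_i F i a * g i) -> U \notin (P : pred _) ->
  azumaya AP.
Proof.
move=> Fop Fc Fdual UP; pose dU := Denom UP.
have [l lE] : exists l : I -> seq (A * A),
    forall i a, F i a = \sum_(c <- l i) c.1 * a * c.2.
  by exists (fun i => sval (cid (Fop i))) => i; case: cid.
pose G i (w : AP) : AP :=
  \sum_(c <- l i) fr c.1 (denom1 P) * w * fr c.2 dU.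
have GE i a s : G i (fr a s) = fr (F i a) (denomM s dU).
  rewrite lE fr_sum; apply: eq_bigr => c _; rewrite !frM.
  by apply: frac_eq; rewrite /= mul1r.
apply: (@azumaya_dual_basis _ AP I (fun i => fr (g i) (denom1 P)) G).
- move=> i; exists [seq (fr c.1 (denom1 P), fr c.2 dU) | c <- l i] => w.
  by rewrite big_map.
- move=> i w; case: (locP w) => a s.
  exists (Defs.frac (P := P) (A := (center A)^o) (Central (Fc i a))
    (denomM s dU)).
  by rewrite scale_fr1 GE.
- move=> w; case: (locP w) => a s; under eq_bigr do rewrite GE frM.
  rewrite -fr_sum -Fdual; apply: frac_eq => /=.
  rewrite mulr1 -[cval U * a]/(U *: (a : over_center A)) scalerA.
  by [].
- move=> r; case: (locP r) => c s; rewrite scale_fr1 => /frac_eqP[u].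
  rewrite /= scale1r !scaler0 => uc.
  have uc0 : den u * c = 0 by apply: val_inj; exact: uc.
  apply/frac_eqP; exists u; rewrite /= scale1r !scaler0; exact: uc0.
Qed.

End LocalizedCriterion.

(** * q-integers when [[p]q = 0] *)

Section QuantumNumbers.

Variables (R : comNzRingType) (q : R).
Local Notation "[ n ]q" := (qnat q n) (format "[ n ]q").

Lemma qnat0 : [0]q = 0.
Proof. by rewrite /qnat big_ord0. Qed.

Lemma qnatS n : [n.+1]q = [n]q + q ^+ n.
Proof. by rewrite /qnat big_ord_recr. Qed.

Lemma qnatSl n : [n.+1]q = 1 + q * [n]q.
Proof.
rewrite /qnat big_ord_recl expr0 mulr_sumr; congr (_ + _).
by apply: eq_bigr => i _; rewrite /bump /= exprS.
Qed.

Lemma qnatD m n : [m + n]q = [m]q + q ^+ m * [n]q.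
Proof.
elim: n => [|n IH]; first by rewrite addn0 qnat0 mulr0 addr0.
by rewrite addnS !qnatS IH mulrDr addrA exprD.
Qed.

Lemma qnatM m n : [m * n]q = [m]q * qnat (q ^+ m) n.
Proof.
elim: n => [|n IH]; first by rewrite muln0 qnat0 /qnat big_ord0 mulr0.
rewrite mulnS addnC qnatD IH /qnat [X in _ = _ * X]big_ord_recr /= exprM.
by rewrite mulrDr [q ^+ m ^+ n * _]mulrC.
Qed.

Lemma qexp_sub1 n : q ^+ n - 1 = (q - 1) * [n]q.
Proof. exact: subrX1. Qed.

Variable p : nat.
Hypothesis qnat_p : [p]q = 0.

Lemma qexp_p : q ^+ p = 1.
Proof. by apply/eqP; rewrite -subr_eq0 qexp_sub1 qnat_p mulr0. Qed.

Lemma qexp_addMp n m : q ^+ (n + m * p) = q ^+ n.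
Proof. by rewrite exprD mulnC exprM qexp_p expr1n mulr1. Qed.

Lemma qnat_addMp n m : [n + m * p]q = [n]q.
Proof. by rewrite qnatD mulnC qnatM qnat_p mul0r mulr0 addr0. Qed.

Lemma qnat_dvd n : (p %| n)%N -> [n]q = 0.
Proof. by move=> /dvdnP[m ->]; rewrite -[(m * p)%N]add0n qnat_addMp qnat0. Qed.

(** From a Bezout relation mn = kp + 1, the product of [[n]q] and the q^n-integer of m is the
    q-integer of kp + 1, which is 1. *)
Lemma qnat_unit n : prime p -> ~~ (p %| n)%N -> exists v, [n]q * v = 1.
Proof.
move=> pr_p; rewrite -prime_coprime // coprime_sym => co.
have [|m k e _] := egcdnP p (m := n).
  by case: n co => //; rewrite /coprime gcd0n => /eqP p1; rewrite p1 in pr_p.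
exists (qnat (q ^+ n) m).
rewrite -qnatM mulnC e (eqP co) addnC qnat_addMp.
by rewrite qnatS qnat0 add0r expr0.
Qed.

(* [z ^+ p.-1] applied after [ad x] sends [y ^+ a * x ^+ b] to                *)
(* [qcoef a *: (z ^+ p * y ^+ a.-1 * x ^+ b)], where [z = x * y - y * x].     *)
Definition qcoef a : R := [a]q * q ^+ (p.-1 * a.-1).

Definition qcoef_prod n a : R := \prod_(k < n) qcoef (a - k).

(** The factor of index [a %% p] carries the q-integer of a multiple of [p], which vanishes. *)
Lemma qcoef_prod_eq0 a : (0 < p)%N -> (a %% p)%N != p.-1 ->
  qcoef_prod p.-1 a = 0.
Proof.
move=> p_gt0 ap; have lt : (a %% p < p.-1)%N.
  by rewrite ltn_neqAle ap -ltnS prednK // ltn_pmod.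
rewrite /qcoef_prod (bigD1 (Ordinal lt)) //= /qcoef.
rewrite [[_]q]qnat_dvd ?mul0r ?mul0r //.
by rewrite {1}(divn_eq a p) addnK dvdn_mull.
Qed.

Lemma qcoef_prod_period a : (0 < p)%N -> (a %% p)%N = p.-1 ->
  qcoef_prod p.-1 a = qcoef_prod p.-1 p.-1.
Proof.
move=> p_gt0 ap; apply: eq_bigr => k _.
have -> : (a - k = p.-1 - k + a %/ p * p)%N.
  by rewrite {1}(divn_eq a p) ap addnC addnBAC // ltnW.
rewrite /qcoef qnat_addMp; congr (_ * _).
(* Positivity lets the truncated predecessor commute with adding a multiple of [p]. *)
have k_gt0 : (0 < p.-1 - k)%N by rewrite subn_gt0.
rewrite -[(p.-1 - k)%N]prednK // addSn /= mulnDr mulnA.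
by rewrite qexp_addMp.
Qed.

Lemma qcoef_prod_unit : prime p -> exists v, qcoef_prod p.-1 p.-1 * v = 1.
Proof.
move=> pr_p; have p_gt0 := prime_gt0 pr_p.
have {}U (k : 'I_p.-1) : exists v, qcoef (p.-1 - k) * v = 1.
  have k_gt0 : (0 < p.-1 - k)%N by rewrite subn_gt0.
  have [|v v1] := @qnat_unit (p.-1 - k) pr_p.
    by rewrite gtnNdvd // (leq_ltn_trans (leq_subr _ _)) // prednK.
  (* With n = p - 1 - k, the powers of [q] with exponents (p - 1)(n - 1) and n - 1 multiply to a
     power of q^p = 1. *)
  exists (v * q ^+ (p.-1 - k).-1); rewrite /qcoef mulrACA v1 mul1r -exprD.
  rewrite -mulSnr prednK // mulnC.
  by rewrite -[(_ * p)%N]add0n qexp_addMp.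
exists (\prod_(k < p.-1) sval (cid (U k))).
rewrite -big_split big1 // => k _ /=; by case: cid.
Qed.

End QuantumNumbers.

(** * Commutators as q-derivatives, and the coordinates they extract *)

Section QuantumWeylSandwich.

Variables (R : comNzRingType) (q : R) (A : algType R) (x y : A).
Hypothesis xy_rel : x * y = q *: (y * x) + 1.
Local Notation "[ n ]q" := (qnat q n) (format "[ n ]q").

Definition qcomm : A := x * y - y * x.
Local Notation z := qcomm.

Lemma qcommE : z = (q - 1) *: (y * x) + 1.
Proof. by rewrite /qcomm xy_rel scalerBl scale1r addrAC. Qed.

Lemma qcomm_x : x * z = q *: (z * x).
Proof.
rewrite qcommE mulrDr mulrDl mulr1 mul1r -scalerAr -scalerAl mulrA xy_rel.
rewrite mulrDl mul1r -scalerAl !scalerDr !scalerA -addrA; congr (_ + _).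
  by rewrite mulrC.
by rewrite scalerBl scale1r subrK.
Qed.

Lemma qcomm_y : z * y = q *: (y * z).
Proof.
rewrite qcommE mulrDr mulrDl mulr1 mul1r -scalerAr -scalerAl -mulrA xy_rel.
rewrite mulrDr mulr1 -scalerAr !scalerDr !scalerA -addrA; congr (_ + _).
  by rewrite mulrC.
by rewrite scalerBl scale1r subrK.
Qed.

Lemma qcommX_yX m n : z ^+ m * y ^+ n = q ^+ (m * n) *: (y ^+ n * z ^+ m).
Proof.
have z_yX k : z * y ^+ k = q ^+ k *: (y ^+ k * z).
  elim: k => [|k IH]; first by rewrite !expr0 mulr1 mul1r scale1r.
  rewrite exprS mulrA qcomm_y -scalerAl -[y * z * _]mulrA IH -scalerAr scalerA.
  by rewrite mulrA exprS.
elim: m => [|m IH]; first by rewrite !expr0 mulr1 mul1r scale1r.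
rewrite exprS -mulrA IH -scalerAr [in LHS]mulrA z_yX -scalerAl scalerA -mulrA.
by rewrite -exprD mulSn addnC.
Qed.

Lemma qcommX_xX m n : x ^+ n * z ^+ m = q ^+ (m * n) *: (z ^+ m * x ^+ n).
Proof.
have xX_z k : x ^+ k * z = q ^+ k *: (z * x ^+ k).
  elim: k => [|k IH]; first by rewrite !expr0 mulr1 mul1r scale1r.
  rewrite exprSr -mulrA qcomm_x -scalerAr [_ * (z * x)]mulrA IH -scalerAl.
  rewrite scalerA.
  by rewrite -mulrA [in RHS]exprS.
elim: m => [|m IH]; first by rewrite !expr0 mulr1 mul1r scale1r.
rewrite exprSr [x ^+ n * _]mulrA IH -scalerAl -[z ^+ m * x ^+ n * z]mulrA xX_z.
by rewrite -scalerAr scalerA [in LHS]mulrA -exprD mulSnr.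
Qed.

(** Moving [x] through y^a leaves (q^a - 1) y^a x + [a] y^(a-1). As q^a - 1 = (q - 1)[a], this is
    [a] y^(a-1) z. For [a = 0] the truncated [a.-1] is harmless, [[0]q] being zero. *)
Lemma comm_x_monomial a b :
  x * (y ^+ a * x ^+ b) - y ^+ a * x ^+ b * x =
  [a]q *: (y ^+ a.-1 * z * x ^+ b).
Proof.
case: a => [|a] /=.
  by rewrite expr0 !mul1r qnat0 scale0r -exprS -exprSr subrr.
rewrite mulrA (qcomm_x_yn xy_rel) mulrDl -!scalerAl -!mulrA -exprS -exprSr.
rewrite addrAC -[X in _ - X]scale1r -scalerBl subrX1 -/(qnat q a.+1).
rewrite qcommE [in RHS]mulrDl [in RHS]mulrDr mul1r scalerDr; congr (_ + _).
rewrite -scalerAl -scalerAr scalerA mulrC; congr (_ *: _).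
by rewrite exprSr exprS !mulrA.
Qed.

Lemma comm_monomial_y a b :
  y ^+ a * x ^+ b * y - y * (y ^+ a * x ^+ b) =
  [b]q *: (y ^+ a * z * x ^+ b.-1).
Proof.
case: b => [|b] /=.
  by rewrite expr0 !mulr1 qnat0 scale0r -exprS -exprSr subrr.
rewrite -mulrA (qcomm_xn_y xy_rel) mulrDr -!scalerAr [y ^+ a * (y * _)]mulrA.
rewrite [y * (y ^+ a * _)]mulrA -exprS -exprSr.
rewrite addrAC -[X in _ - X]scale1r -scalerBl subrX1 -/(qnat q b.+1).
rewrite qcommE [in RHS]mulrDr [in RHS]mulrDl mulr1 scalerDr; congr (_ + _).
rewrite -scalerAr -scalerAl scalerA mulrC; congr (_ *: _).
by rewrite exprSr exprS !mulrA.
Qed.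

Variable p : nat.
Hypothesis pr_p : prime p.
Hypothesis qnat_p : [p]q = 0.
Local Notation u := (z ^+ p).

Let p_gt0 : (0 < p)%N. Proof. exact: prime_gt0. Qed.

Lemma qcommXp_y : u * y = y * u.
Proof.
by rewrite -[y in LHS]expr1 qcommX_yX muln1 qexp_p // scale1r.
Qed.

Lemma qcommXp_x : x * u = u * x.
Proof.
by rewrite -[x in LHS]expr1 qcommX_xX muln1 qexp_p // scale1r.
Qed.

Lemma qcommXp_yX n : u * y ^+ n = y ^+ n * u.
Proof.
by rewrite qcommX_yX mulnC -[(_ * p)%N]add0n qexp_addMp // expr0 scale1r.
Qed.

(** [z ^+ p.-1] replaces the inverse of [z] up to the factor z^p, so the q-derivative exists before
    any localization. *)
Definition qder_y (f : A) : A := z ^+ p.-1 * (x * f - f * x).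
Definition qder_x (f : A) : A := (f * y - y * f) * z ^+ p.-1.

Lemma qder_y_monomial a b :
  qder_y (y ^+ a * x ^+ b) = qcoef q p a *: (u * (y ^+ a.-1 * x ^+ b)).
Proof.
rewrite /qder_y comm_x_monomial -scalerAr /qcoef -scalerA; congr (_ *: _).
rewrite !mulrA qcommXp_yX qcommX_yX -!scalerAl; congr (_ *: (_ * _)).
by rewrite -[_ * z]mulrA -exprSr prednK.
Qed.

Lemma qder_x_monomial a b :
  qder_x (y ^+ a * x ^+ b) = qcoef q p b *: (u * (y ^+ a * x ^+ b.-1)).
Proof.
rewrite /qder_x comm_monomial_y -scalerAl /qcoef -scalerA; congr (_ *: _).
rewrite -[_ * z ^+ p.-1]mulrA qcommX_xX -!scalerAr; congr (_ *: _).
rewrite [in RHS]mulrA qcommXp_yX mulrA -[_ * z * _]mulrA -exprS prednK //.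
Qed.

Lemma qder_y_sandwich : sandwich_op qder_y.
Proof.
have := sandwich_op_comp (sandwich_op_mul (z ^+ p.-1) 1)
  (sandwich_opB (sandwich_op_mul x 1) (sandwich_op_mul 1 x)).
by apply: eq_sandwich_op => a /=; rewrite !mulr1 mul1r.
Qed.

Lemma qder_x_sandwich : sandwich_op qder_x.
Proof.
have := sandwich_op_comp (sandwich_op_mul 1 (z ^+ p.-1))
  (sandwich_opB (sandwich_op_mul 1 y) (sandwich_op_mul y 1)).
by apply: eq_sandwich_op => a /=; rewrite !mulr1 !mul1r.
Qed.

Hypothesis u_central : forall a, a * u = u * a.

Let uX_central n a : a * u ^+ n = u ^+ n * a.
Proof. by apply: commrX; apply: u_central. Qed.

Lemma iter_qder_y_monomial n a b :
  iter n qder_y (y ^+ a * x ^+ b) =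
  qcoef_prod q p n a *: (u ^+ n * (y ^+ (a - n) * x ^+ b)).
Proof.
elim: n => [|n IH].
  by rewrite /qcoef_prod big_ord0 scale1r expr0 mul1r subn0.
rewrite iterS IH (sandwich_opZ _ _ qder_y_sandwich).
rewrite (sandwich_op_centralMl _ qder_y_sandwich (uX_central n)).
rewrite qder_y_monomial -scalerAr scalerA [u ^+ n * _]mulrA -exprSr -subnS.
by rewrite /qcoef_prod [in RHS]big_ord_recr.
Qed.

Lemma iter_qder_x_monomial n a b :
  iter n qder_x (y ^+ a * x ^+ b) =
  qcoef_prod q p n b *: (u ^+ n * (y ^+ a * x ^+ (b - n))).
Proof.
elim: n => [|n IH].
  by rewrite /qcoef_prod big_ord0 scale1r expr0 mul1r subn0.
rewrite iterS IH (sandwich_opZ _ _ qder_x_sandwich).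
rewrite (sandwich_op_centralMl _ qder_x_sandwich (uX_central n)).
rewrite qder_x_monomial -scalerAr scalerA [u ^+ n * _]mulrA -exprSr -subnS.
by rewrite /qcoef_prod [in RHS]big_ord_recr.
Qed.

(* Up to the factor [u ^+ (p.-1 + p.-1)], the coordinate of index [(i, j)] on *)
(* the basis [y ^+ i * x ^+ j], [i, j < p], over the center.                  *)
Definition qcoord v i j (f : A) : A := (v * v) *:
  iter p.-1 qder_x (iter p.-1 qder_y (y ^+ (p.-1 - i) * f * x ^+ (p.-1 - j))).

Lemma qcoord_sandwich v i j : sandwich_op (qcoord v i j).
Proof.
have := sandwich_op_comp (sandwich_op_mul (v * v)%:A 1)
  (sandwich_op_comp (sandwich_op_iter p.-1 qder_x_sandwich)
  (sandwich_op_comp (sandwich_op_iter p.-1 qder_y_sandwich)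
  (sandwich_op_mul (y ^+ (p.-1 - i)) (x ^+ (p.-1 - j))))).
by apply: eq_sandwich_op => f /=; rewrite mulr1 -scalerAl mul1r.
Qed.

(** The outer multiplications move the residues [i] and [j] of the exponents to p - 1, the only
    residue that survives p - 1 derivations. The remaining exponents are multiples of [p]. *)
Lemma qcoord_monomial v i j a b : qcoef_prod q p p.-1 p.-1 * v = 1 ->
  (i < p)%N -> (j < p)%N -> qcoord v i j (y ^+ a * x ^+ b) =
  if (a %% p == i)%N && (b %% p == j)%N
  then u ^+ (p.-1 + p.-1) * (y ^+ (a - i) * x ^+ (b - j)) else 0.
Proof.
move=> ev ltip ltjp; rewrite /qcoord.
have modE c k : (k < p)%N -> ((p.-1 - k + c) %% p == p.-1)%N = (c %% p == k)%N.
  move=> ltkp; have e : (p.-1 = (p.-1 - k + k) %% p)%N.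
    by rewrite subnK ?modn_small ?prednK // -ltnS prednK.
  by rewrite [X in (_ == X)%N]e eqn_modDl [X in (_ == X)%N]modn_small.
have subE c k : (k < p)%N -> (p.-1 - k + c - p.-1 = c - k)%N.
  move=> ltkp; rewrite -[X in (_ + _ - X)%N](@subnK k p.-1) ?subnDl //.
  by rewrite -ltnS prednK.
have -> : y ^+ (p.-1 - i) * (y ^+ a * x ^+ b) * x ^+ (p.-1 - j) =
    y ^+ (p.-1 - i + a) * x ^+ (p.-1 - j + b).
  by rewrite mulrA -exprD -mulrA -exprD [(b + _)%N]addnC.
have iter_op n := sandwich_op_iter n qder_x_sandwich.
rewrite iter_qder_y_monomial (sandwich_opZ _ _ (iter_op _)).
rewrite (sandwich_op_centralMl _ (iter_op _) (uX_central _)).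
rewrite iter_qder_x_monomial -scalerAr !scalerA !subE //.
rewrite [u ^+ _ * (u ^+ _ * _)]mulrA -exprD.
case: ifP => [/andP[ai bj]|/negbT]; last first.
  rewrite negb_and => /orP[] nmod.
    rewrite [qcoef_prod _ _ _ (_ + a)]qcoef_prod_eq0 ?modE //.
    by rewrite mulr0 mul0r scale0r.
  by rewrite [qcoef_prod _ _ _ (_ + b)]qcoef_prod_eq0 ?modE // mulr0 scale0r.
have -> : qcoef_prod q p p.-1 (p.-1 - i + a) = qcoef_prod q p p.-1 p.-1.
  by apply: qcoef_prod_period => //; apply/eqP; rewrite modE.
have -> : qcoef_prod q p p.-1 (p.-1 - j + b) = qcoef_prod q p p.-1 p.-1.
  by apply: qcoef_prod_period => //; apply/eqP; rewrite modE.
(* Each of the two variables contributes one factor inverse to [v]. *)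
by rewrite -mulrA mulrACA [v * _]mulrC ev mulr1 scale1r.
Qed.

End QuantumWeylSandwich.

(** * The q-binomial formula for the powers of [z] *)

Section QuantumBinomial.

Variables (R : comNzRingType) (q : R).
Local Notation "[ n ]q" := (qnat q n) (format "[ n ]q").

(* [gauss n k] is [q ^+ 'C(k, 2)] times the Gaussian binomial coefficient.    *)
Fixpoint gauss n k : R :=
  match n, k with
  | n'.+1, k'.+1 => q ^+ k'.+1 * gauss n' k'.+1 + q ^+ k' * gauss n' k'
  | 0, k'.+1 => 0
  | _, 0 => 1
  end.

Lemma gauss0 n : gauss n 0 = 1.
Proof. by case: n. Qed.

Lemma gaussS n k :
  gauss n.+1 k.+1 = q ^+ k.+1 * gauss n k.+1 + q ^+ k * gauss n k.
Proof. by []. Qed.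

Arguments gauss : simpl never.

Lemma gauss_small n k : (n < k)%N -> gauss n k = 0.
Proof.
elim: n k => [|n IH] [|k] // ltnk.
by rewrite gaussS !IH // ?mulr0 ?addr0 // ltnW.
Qed.

Lemma gauss_diag n : gauss n n = q ^+ 'C(n, 2).
Proof.
elim: n => [|n IH]; first by rewrite bin0n.
by rewrite gaussS gauss_small // mulr0 add0r IH -exprD binS bin1 addnC.
Qed.

(** The absorption identity for Gaussian binomials, in a division-free form. *)
Lemma mul_gauss n k :
  [k.+1]q * gauss n.+1 k.+1 = [n.+1]q * (q ^+ k * gauss n k).
Proof.
elim: n k => [|n IH] k.
  case: k => [|k]; rewrite gaussS gauss_small // mulr0 add0r //.
  by rewrite gauss_small // !mulr0.
rewrite gaussS mulrDr mulrCA IH.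
(* The induction hypothesis at [k.-1], rewritten by the recursion so as to cover [k = 0] too. *)
have e : [k.+1]q * gauss n.+1 k =
    gauss n.+1 k + q * [n.+1]q * (gauss n.+1 k - q ^+ k * gauss n k).
  case: k => [|k].
    by rewrite !gauss0 qnatSl qnat0 mulr0 addr0 expr0 !mulr1 subrr mulr0 addr0.
  rewrite [[k.+2]q]qnatSl mulrDl mul1r -mulrA IH -mulrA.
  congr (_ + _ * (_ * _)).
  by rewrite gaussS addrC addKr.
rewrite [[k.+1]q * (q ^+ k * _)]mulrCA e [[n.+2]q]qnatSl exprS.
ring.
Qed.

Variable p : nat.
Hypothesis pr_p : prime p.
Hypothesis qnat_p : [p]q = 0.

Lemma gauss_prime k : (0 < k < p)%N -> gauss p k = 0.
Proof.
case: k => // k /andP[_ ltkp].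
have [|v v1] := @qnat_unit _ q p qnat_p k.+1 pr_p; first by rewrite gtnNdvd.
rewrite -[gauss p _]mul1r -v1 mulrAC.
case: p qnat_p ltkp => // p' p0 _.
by rewrite mul_gauss p0 !mul0r.
Qed.

Variables (A : algType R) (x y : A).
Hypothesis xy_rel : x * y = q *: (y * x) + 1.

(** By z y^k x^k = q^k y^k z x^k and z = 1 + (q - 1)yx, multiplying by [z] produces the two terms of
    the recursion of [gauss]. *)
Lemma qcomm_exp n : qcomm x y ^+ n =
  \sum_(k < n.+1) (gauss n k * (q - 1) ^+ k) *: (y ^+ k * x ^+ k).
Proof.
elim: n => [|n IH]; first by rewrite big_ord1 gauss0 !expr0 !mulr1 scale1r.
have zm k : qcomm x y * (y ^+ k * x ^+ k) =
    q ^+ k *: (y ^+ k * x ^+ k) + (q ^+ k * (q - 1)) *: (y ^+ k.+1 * x ^+ k.+1).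
  rewrite mulrA -[qcomm x y in LHS]expr1 (qcommX_yX xy_rel) mul1n expr1.
  rewrite -scalerAl.
  rewrite -scalerA -scalerDr; congr (_ *: _).
  rewrite (qcommE xy_rel) mulrDr mulr1 mulrDl addrC; congr (_ + _).
  by rewrite -scalerAr -scalerAl exprSr exprS !mulrA.
rewrite exprS IH mulr_sumr.
under eq_bigr => k _ do rewrite -scalerAr zm scalerDr !scalerA.
rewrite big_split /= [in RHS]big_ord_recl.
under [X in _ = _ + X]eq_bigr => k _ do
  rewrite lift0 gaussS mulrDl scalerDl.
rewrite big_split addrA /=; congr (_ + _); last first.
  by apply: eq_bigr => k _; congr (_ *: _); rewrite exprS; ring.
transitivity (\sum_(k < n.+2)
    (gauss n k * (q - 1) ^+ k * q ^+ k) *: (y ^+ k * x ^+ k)).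
  by rewrite [RHS]big_ord_recr /= gauss_small // !mul0r scale0r addr0.
rewrite big_ord_recl /= gauss0 !expr0 !mulr1; congr (_ + _).
by apply: eq_bigr => k _; rewrite /bump leq0n add1n; congr (_ *: _); ring.
Qed.

(** Only the extreme terms survive. Oddness makes [p] divide ['C(p, 2)], so the top coefficient
    q^C(p, 2) is 1; for p = 2 it would be q = -1. *)
Lemma qcomm_expp : odd p ->
  qcomm x y ^+ p = 1 + (q - 1) ^+ p *: (y ^+ p * x ^+ p).
Proof.
move=> p_odd; have p_gt2 := odd_prime_gt2 p_odd pr_p.
rewrite qcomm_exp big_ord_recr /= gauss_diag.
have /dvdnP[m ->] : (p %| 'C(p, 2))%N by rewrite prime_dvd_bin.
rewrite -[(m * p)%N]add0n qexp_addMp // expr0 mul1r; congr (_ + _).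
rewrite -(prednK (prime_gt0 pr_p)) big_ord_recl /= gauss0 big1; last first.
  move=> k _; have := ltn_ord k; rewrite -ltnS prednK ?prime_gt0 // => ltkp.
  by rewrite /bump leq0n add1n gauss_prime // mul0r scale0r.
by rewrite addr0 !expr0 !mulr1 scale1r.
Qed.

End QuantumBinomial.

(** * The q-derivative on polynomials and the action of [x] *)

Section QuantumDerivative.

Variables (R : comNzRingType) (q : R).
Local Notation "[ n ]q" := (qnat q n) (format "[ n ]q").
Local Notation sigma := (comp_poly (q *: 'X)).

Lemma coef_qscale (g : {poly R}) i : (sigma g)`_i = q ^+ i * g`_i.
Proof.
rewrite comp_polyE coef_sum.
under eq_bigr => j _ do rewrite exprZn coefZ coefZ coefXn.
case: (ltnP i (size g)) => [lti|le].
  rewrite (bigD1 (Ordinal lti)) //= eqxx mulr1 mulrC big1 ?addr0 // => j.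
  by rewrite -val_eqE /= eq_sym => /negbTE->; rewrite !mulr0.
rewrite nth_default // mulr0 big1 // => j _.
by rewrite eqn_leq leqNgt (leq_trans (ltn_ord j) le) !mulr0.
Qed.

Lemma qderiv_additive : zmod_morphism (qderiv q).
Proof.
by move=> f g; apply/polyP => i; rewrite coefB !coef_qderiv coefB mulrBr.
Qed.
HB.instance Definition _ := GRing.isZmodMorphism.Build {poly R} {poly R}
  (qderiv q) qderiv_additive.

Lemma qderivZ k f : qderiv q (k *: f) = k *: qderiv q f.
Proof. by apply/polyP => i; rewrite coefZ !coef_qderiv coefZ mulrCA. Qed.

Lemma qderivMX f : qderiv q (f * 'X) = qderiv q f * 'X + sigma f.
Proof.
apply/polyP => i; rewrite coefD coef_qderiv !coefMX coef_qscale /= coef_qderiv.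
case: i => [|i] /=; first by rewrite qnatS qnat0 expr0 !add0r.
by rewrite qnatS mulrDl.
Qed.

Lemma qderivXM f : qderiv q ('X * f) = q *: ('X * qderiv q f) + f.
Proof.
apply/polyP => i; rewrite coefD coefZ coef_qderiv !coefXM /= coef_qderiv.
case: i => [|i] /=; first by rewrite qnatS qnat0 expr0 mulr0 !add0r mul1r.
by rewrite qnatSl mulrDl mul1r mulrA addrC.
Qed.

Lemma qscaleXM f : sigma ('X * f) = q *: ('X * sigma f).
Proof. by rewrite rmorphM /= comp_polyX -scalerAl. Qed.

(* The left regular representation of the quantum Weyl algebra on the basis   *)
(* [y ^+ j * x ^+ i]: [f : {poly {poly R}}] stands for                        *)
(* [\sum_i \sum_j f`_i`_j *: (y ^+ j * x ^+ i)].                              *)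
Definition xact (f : {poly {poly R}}) : {poly {poly R}} :=
  map_poly sigma f * 'X + map_poly (qderiv q) f.

Lemma coef_xact f i : (xact f)`_i =
  (if i is j.+1 then sigma f`_j else 0) + qderiv q f`_i.
Proof. by rewrite /xact coefD coefMX !coef_map; case: i. Qed.

Lemma xactB : {morph xact : f g / f - g}.
Proof. by move=> f g; rewrite /xact !raddfB /= mulrBl addrACA opprD. Qed.

Lemma xactZ k f : xact (k%:P *: f) = k%:P *: xact f.
Proof.
apply/polyP => i; rewrite coefZ !coef_xact mulrDr coefZ !mul_polyC qderivZ.
by case: i => [|i]; rewrite ?scaler0 // coefZ mul_polyC linearZ.
Qed.

End QuantumDerivative.

(** * Normal ordering: from polynomials to the algebra *)

Section FromCoordinates.

Variables (R : comNzRingType) (q : R) (A : algType R) (x y : A).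
Hypothesis xy_rel : x * y = q *: (y * x) + 1.
Local Notation sigma := (comp_poly (q *: 'X)).

(** The inner variable is evaluated at [y] and the outer one at [x], with powers of [x] on the
    right. *)
Definition from_coord (f : {poly {poly R}}) : A :=
  (map_poly (horner_alg y) f).[x].

Lemma from_coord0 : from_coord 0 = 0.
Proof. by rewrite /from_coord raddf0 horner0. Qed.

Lemma from_coord1 : from_coord 1 = 1.
Proof. by rewrite /from_coord rmorph1 hornerC. Qed.

Lemma from_coordZ a f : from_coord (a *: f) = horner_alg y a * from_coord f.
Proof. by rewrite /from_coord map_polyZ hornerZ. Qed.

Lemma from_coordCZ k f : from_coord (k%:P *: f) = k *: from_coord f.
Proof. by rewrite from_coordZ horner_algC -scalerAl mul1r. Qed.

Lemma from_coordD f g : from_coord (f + g) = from_coord f + from_coord g.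
Proof. by rewrite /from_coord raddfD hornerD. Qed.

Lemma from_coord_sum (I : Type) (r : seq I) (F : I -> {poly {poly R}}) :
  from_coord (\sum_(i <- r) F i) = \sum_(i <- r) from_coord (F i).
Proof. exact: (big_morph from_coord from_coordD from_coord0). Qed.

Lemma from_coordMX f : from_coord (f * 'X) = from_coord f * x.
Proof. by rewrite /from_coord rmorphM /= map_polyX hornerMX. Qed.

Lemma from_coordC a : from_coord a%:P = horner_alg y a.
Proof. by rewrite /from_coord map_polyC hornerC. Qed.

Lemma from_coordE f : from_coord f =
  \sum_(i < size (map_poly (horner_alg y) f))
    \sum_(j < size (map_poly (in_alg A) f`_i)) f`_i`_j *: (y ^+ j * x ^+ i).
Proof.
rewrite /from_coord horner_coef; apply: eq_bigr => i _.
rewrite coef_map /= /horner_alg /= /horner_morph horner_coef mulr_suml.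
by apply: eq_bigr => j _; rewrite coef_map /= -scalerAl mul1r -scalerAl.
Qed.

(** The twisted Leibniz rule [qderivMX] propagates the defining relation by induction on [g]. *)
Lemma qcomm_x_horner g : x * horner_alg y g =
  horner_alg y (sigma g) * x + horner_alg y (qderiv q g).
Proof.
elim/poly_ind: g => [|g c IH]; first by rewrite !raddf0 mulr0 mul0r addr0.
have dc : qderiv q c%:P = 0.
  by apply/polyP => i; rewrite coef_qderiv coefC mulr0 coef0.
have e : horner_alg y (sigma (g * 'X + c%:P)) =
    q *: (horner_alg y (sigma g) * y) + c%:A.
  rewrite comp_polyD comp_polyM comp_polyX comp_polyC rmorphD -scalerAr.
  rewrite -mul_polyC !rmorphM /= horner_algX !horner_algC.
  by rewrite -scalerAl mul1r.
have d : horner_alg y (qderiv q (g * 'X + c%:P)) =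
    horner_alg y (qderiv q g) * y + horner_alg y (sigma g).
  have -> : qderiv q (g * 'X + c%:P) = qderiv q g * 'X + sigma g.
    rewrite -qderivMX -[RHS]addr0 -dc; exact: raddfD.
  by rewrite rmorphD rmorphM /= horner_algX.
rewrite e d rmorphD rmorphM /= horner_algX horner_algC.
rewrite mulrDr mulrA IH !mulrDl -[_ * x * y]mulrA xy_rel mulrDr mulr1.
rewrite -scalerAr -scalerAr -!scalerAl mulr1 mul1r -[_ * y * x]mulrA.
by rewrite -!addrA; congr (_ + _); rewrite [LHS]addrC -addrA [LHS]addrCA.
Qed.

Lemma from_coord_x f : x * from_coord f = from_coord (xact q f).
Proof.
elim/poly_ind: f => [|f c IH].
  by rewrite /xact !raddf0 mul0r addr0 from_coord0 mulr0.
have -> : xact q (f * 'X + c%:P) =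
    xact q f * 'X + (sigma c)%:P * 'X + (qderiv q c)%:P.
  have dX : map_poly (qderiv q) (f * 'X) = map_poly (qderiv q) f * 'X.
    apply/polyP => i; rewrite coef_map !coefMX; case: i => [|i] /=.
      exact: raddf0.
    by rewrite coef_map.
  have dD : map_poly (qderiv q) (f * 'X + c%:P) =
      map_poly (qderiv q) f * 'X + (qderiv q c)%:P.
    by rewrite raddfD /= dX map_polyC.
  have sD : map_poly sigma (f * 'X + c%:P) =
      map_poly sigma f * 'X + (sigma c)%:P.
    by rewrite rmorphD rmorphM /= map_polyX map_polyC.
  by rewrite /xact dD sD !mulrDl addrACA addrA.
rewrite !from_coordD !from_coordMX !from_coordC mulrDr qcomm_x_horner.
by rewrite mulrA IH addrA.
Qed.

Lemma from_coord_y f : y * from_coord f = from_coord ('X *: f).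
Proof. by rewrite from_coordZ horner_algX. Qed.

End FromCoordinates.

(** * Monomials span the quantum Weyl algebra, and [z] is regular *)

Section QuantumWeylBasis.

Variables (R : comNzRingType) (q : R).
Local Notation B := (qweyl q).
Local Notation X := (qweyl_x q).
Local Notation Y := (qweyl_y q).
Local Notation sigma := (comp_poly (q *: 'X)).
Local Notation xact := (xact q).
Local Notation from_coord := (@from_coord R B X Y).

Definition letter_reg (b : bool) f := if b then xact f else 'X *: f.

Definition word_reg (w : {fmonom bool}) (f : {poly {poly R}}) :=
  foldr letter_reg f w.

Lemma word_regB w : {morph word_reg w : f g / f - g}.
Proof.
rewrite /word_reg; elim: (w : seq bool) => //= -[] s IH f g; rewrite IH /=.
  exact: xactB.
exact: scalerBr.
Qed.

Lemma word_regZ w k f : word_reg w (k%:P *: f) = k%:P *: word_reg w f.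
Proof.
rewrite /word_reg; elim: (w : seq bool) => //= -[] s IH; rewrite IH /=.
  exact: xactZ.
by rewrite !scalerA mulrC.
Qed.

Definition free_reg (u : free_alg R) (f : {poly {poly R}}) : {poly {poly R}} :=
  mmap (polyC \o (@polyC R)) (fun w => word_reg w f) u.

Lemma free_regU c w f : free_reg << c *g w >> f = c%:P *: word_reg w f.
Proof. by rewrite /free_reg mmapU mul_polyC. Qed.

Lemma free_regE u f :
  free_reg u f = \sum_(w <- msupp u) (u@_w)%:P *: word_reg w f.
Proof.
by rewrite /free_reg mmapE; apply: eq_bigr => w _; rewrite mul_polyC.
Qed.

Lemma free_regBl (u v : free_alg R) f :
  free_reg (u - v) f = free_reg u f - free_reg v f.
Proof. exact: raddfB. Qed.

Lemma free_reg_suml (I : Type) (r : seq I) (F : I -> free_alg R) f :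
  free_reg (\sum_(i <- r) F i) f = \sum_(i <- r) free_reg (F i) f.
Proof. exact: raddf_sum. Qed.

HB.instance Definition _ w := GRing.isZmodMorphism.Build
  {poly {poly R}} {poly {poly R}} (word_reg w) (word_regB w).

Lemma free_regM (u v : free_alg R) f :
  free_reg (u * v) f = free_reg u (free_reg v f).
Proof.
rewrite malgME [LHS]raddf_sum [RHS]free_regE.
apply: eq_bigr => w _; rewrite raddf_sum free_regE raddf_sum scaler_sumr.
apply: eq_bigr => w' _; rewrite /= word_regZ scalerA -polyCM.
by rewrite [LHS]free_regU /word_reg fmM foldr_cat.
Qed.

Lemma free_regZ k (u : free_alg R) f :
  free_reg (k *: u) f = k%:P *: free_reg u f.
Proof. by rewrite -(mul_malgC k u) free_regM free_regU /word_reg fm1. Qed.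

Lemma free_reg1 f : free_reg 1 f = f.
Proof. by rewrite free_regU scale1r /word_reg fm1. Qed.

Lemma free_reg_x f : free_reg (free_x R) f = xact f.
Proof. by rewrite free_regU scale1r /word_reg fmU. Qed.

Lemma free_reg_y f : free_reg (free_y R) f = 'X *: f.
Proof. by rewrite free_regU scale1r /word_reg fmU. Qed.

Lemma free_reg0 u : free_reg u 0 = 0.
Proof. by rewrite free_regE big1 // => w _; rewrite raddf0 scaler0. Qed.

(** Used with [k = q] for the relator and with [k = 1] for [z]. *)
Lemma free_reg_qcomm (u v : free_alg R) k f :
  free_reg (u * v - k *: (v * u)) f =
  free_reg u (free_reg v f) - k%:P *: free_reg v (free_reg u f).
Proof.
apply: etrans (free_regBl _ _ _) _.
congr (_ - _); first exact: free_regM.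
by rewrite free_regZ; congr (_ *: _); exact: free_regM.
Qed.

Lemma free_reg_relator f : free_reg (qweyl_relator q) f = 0.
Proof.
have -> : free_reg (qweyl_relator q) f =
    xact ('X *: f) - q%:P *: ('X *: xact f) - f.
  transitivity (free_reg (free_x R * free_y R - q *: (free_y R * free_x R)) f -
    free_reg 1 f); first exact: free_regBl.
  congr (_ - _); last exact: free_reg1.
  apply: etrans (free_reg_qcomm _ _ _ _) _.
  congr (_ - _ *: _).
    exact: etrans (congr1 _ (free_reg_y f)) (free_reg_x _).
  exact: etrans (congr1 _ (free_reg_x f)) (free_reg_y _).
apply/polyP => i.
rewrite !coefB coef0 coef_xact !coefZ coef_xact qderivXM mulrDr mulrDr.
rewrite mul_polyC (mul_polyC q ('X * _)).
case: i => [|i]; rewrite ?mulr0 ?coefZ ?qscaleXM ?add0r; ring.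
Qed.

Lemma free_reg_ideal u f : u \in qweyl_ideal q -> free_reg u f = 0.
Proof.
move=> /asboolP[l ->]; rewrite free_reg_suml big1 // => -[a b] _ /=.
move: (qweyl_relator q) free_reg_relator => r r0.
by rewrite !free_regM r0 free_reg0.
Qed.

Lemma free_reg_pi u v f :
  qweyl_pi q u = qweyl_pi q v -> free_reg u f = free_reg v f.
Proof.
move=> /qweyl_piP uv; apply/eqP; rewrite -subr_eq0 -free_regBl.
by rewrite free_reg_ideal.
Qed.

Lemma qweyl_xyE : X * Y = q *: (Y * X) + 1.
Proof. by apply/eqP; rewrite -subr_eq0 opprD addrA; apply/eqP/qweyl_rel. Qed.

Lemma from_coord_pi u f :
  qweyl_pi q u * from_coord f = from_coord (free_reg u f).
Proof.
rewrite free_regE (monalgE u) qweyl_pi_sum mulr_suml.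
rewrite from_coord_sum -monalgE; apply: eq_bigr => w _.
have -> : qweyl_pi q << u@_w *g w >> = u@_w *: qweyl_pi q << w >>.
  rewrite -qweyl_pi_scale; congr qweyl_pi.
  by rewrite -mul_malgC malgM_def fgmulUU mulr1 mul1m.
rewrite from_coordCZ -scalerAl; congr (_ *: _).
rewrite -[w]fmK /word_reg /=.
elim: (w : seq bool) => [|b s IH] /=.
  by rewrite -fmoneE; apply: mul1r.
have -> : qweyl_pi q << FMonom (b :: s) >> =
    (if b then X else Y) * qweyl_pi q << FMonom s >>.
  have -> : FMonom (b :: s) = mmul (fmu b) (FMonom s).
    by apply/eqP; rewrite fmP fmM fmU.
  have -> : << mmul (fmu b) (FMonom s) >> =
      (<< fmu b >> : free_alg R) * (<< FMonom s >> : free_alg R).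
    by rewrite malgM_def fgmulUU mulr1.
  by case: b; apply: qweyl_pi_mul.
rewrite -mulrA IH; case: b; last exact: from_coord_y.
exact: (from_coord_x qweyl_xyE).
Qed.

Definition coord (b : B) : {poly {poly R}} := free_reg (repr b) 1.

(** [from_coord] turns the action into left multiplication ([from_coord_pi]); apply this to the
    vector 1. *)
Lemma coordK : cancel coord from_coord.
Proof.
move=> b; rewrite /coord -from_coord_pi qweyl_piK.
by rewrite from_coord1 mulr1.
Qed.

Lemma qweyl_ind (Q : B -> Prop) :
  (forall b c, Q b -> Q c -> Q (b + c)) -> (forall k b, Q b -> Q (k *: b)) ->
  (forall i j, Q (Y ^+ i * X ^+ j)) -> forall b, Q b.
Proof.
move=> QD QZ Qmon b; rewrite -[b]coordK.
have Qsum (I : Type) (r : seq I) (F : I -> B) :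
    (forall i, Q (F i)) -> Q (\sum_(i <- r) F i).
  move=> QF; elim/big_rec: _ => [|i c _ Qc]; last exact: QD.
  by rewrite -(scale0r (Y ^+ 0 * X ^+ 0)); apply/QZ/Qmon.
rewrite from_coordE; apply: (@Qsum) => i; apply: Qsum => j; exact/QZ/Qmon.
Qed.

(** In coordinates, the coefficient of x^n in [z * b] is [sigma] of that of [b] plus a term in the
    previous coefficient. As [q] is a unit, [sigma] is injective, and the coefficients vanish one
    after another. *)
Lemma qcomm_lreg q' (b : B) : q * q' = 1 -> qcomm X Y * b = 0 -> b = 0.
Proof.
move=> qq' zb0; rewrite -[b]coordK.
pose v := free_x R * free_y R - free_y R * free_x R.
have : free_reg (v * repr b) 1 = 0.
  transitivity (free_reg 0 1); last exact: raddf0.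
  apply: free_reg_pi; rewrite qweyl_pi_mul qweyl_piK.
  rewrite [RHS](raddf0 (qweyl_pi q)) -[RHS]zb0; congr (_ * _).
  by rewrite /v /qcomm -!qweyl_pi_mul; apply: raddfB.
rewrite free_regM -/(coord b); move: (coord b) => f vf.
suff -> : f = 0 by exact: from_coord0.
have sigma0 g : sigma g = 0 -> g = 0.
  move=> g0; apply/polyP => i; rewrite coef0 -[g`_i]mul1r -(expr1n _ i) -qq'.
  by rewrite exprMn mulrAC -coef_qscale g0 coef0 mul0r.
apply/polyP => i; rewrite coef0.
have vE : free_reg v f = xact ('X *: f) - 'X *: xact f.
  have := free_reg_qcomm (free_x R) (free_y R) 1 f.
  rewrite !scale1r -/v => ->; congr (_ - _).
    exact: etrans (congr1 _ (free_reg_y f)) (free_reg_x _).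
  exact: etrans (congr1 _ (free_reg_x f)) (free_reg_y _).
move: vf; rewrite vE => {vE} vf.
have {}vf n : sigma f`_n =
    - (if n is j.+1 then sigma ('X * f`_j) - 'X * sigma f`_j else 0).
  have := congr1 (fun g : {poly {poly R}} => g`_n) vf.
  rewrite coef0 coefB coefZ !coef_xact coefZ [X in qderiv q X]mulrC qderivMX.
  move=> e; apply/eqP; rewrite -addr_eq0 -[X in _ == X]e; apply/eqP.
  by case: n {e} => [|n]; rewrite ?coefZ; ring.
elim: i => [|i IH]; apply: sigma0; rewrite vf ?oppr0 //.
by rewrite IH mulr0 raddf0 mulr0 subr0 oppr0.
Qed.

End QuantumWeylBasis.

Lemma prime_idealX (C : comNzRingType) (P : prime_idealr C) c n :
  c ^+ n \in (P : pred C) -> c \in (P : pred C).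
Proof.
elim: n => [|n IH]; first by rewrite expr0 idealr1.
by rewrite exprS prime_idealrM => /orP[].
Qed.

(** * A normal element sent to 1 by a central functional *)

Section NormalElementObstruction.

Variables (R : comNzRingType) (A : algType R) (P : prime_idealr (center A)).
Variables (z : A) (n : nat) (u : center A) (f : A -> A).
Hypothesis uE : cval u = z ^+ n.
Hypothesis z_normal : forall a, exists b, a * z = z * b.
Hypothesis f_central : forall a, f a \in central A.
Hypothesis fD : {morph f : a b / a + b}.
Hypothesis fZ : forall (c : center A) a, f (cval c * a) = cval c * f a.
Hypotheses (f1 : f 1 = 1) (fz : f z = 1).
Local Notation AP := (loc_center P).
Local Notation fr a s := (Defs.frac (P := P) (A := over_center A) a s : AP).

Let fP : AP -> AP :=
  loc_lift (P := P) (A := over_center A) (fun a s => fr (f a) s).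

Let fPE a s : fP (fr a s) = fr (f a) s.
Proof.
rewrite /fP loc_liftE // => {}a {}s b t /frac_eqP[r e].
apply/frac_eqP; exists r.
have := congr1 f e; rewrite /GRing.scale /= /center_scale.
by rewrite !fZ.
Qed.

Let fP_linear : linear fP.
Proof.
move=> k v w; case: (locP k) (locP v) (locP w) => c r [a s] [b t].
have frZ d d' e' :
    (Defs.frac (P := P) (A := (center A)^o) c d : loc_ring P) *: fr d' e' =
    fr (cval c * d') (denomM d e') by exact: fracZ.
have frD d d' e e' : fr d e + fr d' e' =
    fr (cval (den e') * d + cval (den e) * d') (denomM e e') by exact: fracD.
by rewrite frZ frD !fPE frZ frD fD !fZ.
Qed.

(* A left and right multiplication maps the two-sided ideal [z A_P = A_P z]   *)
(* to itself, whereas the localization of [f] sends [z] to [1].               *)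
Lemma azumaya_normal_power_notin : azumaya AP -> u \notin (P : pred _).
Proof.
move=> [_ _ _ [_ surj]]; apply/negP => uP.
pose fL : {linear AP -> AP} :=
  HB.pack fP (GRing.isLinear.Build (loc_ring P) AP AP *:%R fP fP_linear).
have [T TE] := surj fL.
pose zP : AP := fr z (denom1 P).
have frM a b s t : fr a s * fr b t = fr (a * b) (denomM s t) by exact: fracM.
(* The tensor realizing the localized [f] is evaluated at [z]: normality pulls [z] to the left of
   every term, and the value is 1. *)
have [v v1] : exists v : AP, zP * v = 1.
  have := TE zP; rewrite [fL zP]fPE fz.
  have [l ->] := tensor_sum T; rewrite sandwich_sum => lz.
  have swap (a : AP) : exists b : AP, a * zP = zP * b.
    case: (locP a) => a0 s; have [b ab] := z_normal a0.
    exists (fr b s); rewrite !frM ab; apply: frac_eq.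
    by rewrite /= mulr1 mul1r.
  exists (\sum_(c <- l) sval (cid (swap c.1)) * c.2).
  apply: etrans lz; rewrite mulr_sumr; apply: eq_bigr => c _.
  by rewrite sandwich_tens mulrA; case: cid => b /= ->.
case: (locP v) v1 => b s; rewrite frM => /frac_eqP[r].
rewrite /GRing.scale /= /center_scale !mul1r mulr1 => e.
(* Clearing denominators gives a central [m] outside [P] with m = zw in [A] itself. *)
pose m := den r * den s.
have mP : m \notin (P : pred _) by rewrite prime_idealrM negb_or !den_notin.
have mE : cval m = z * (cval (den r) * b).
  have /centralP cr := cvalP (den r).
  by rewrite mulrA cr -mulrA e.
have mX k : cval m ^+ k = z ^+ k * (cval (den r) * b) ^+ k.
  have /centralP cm := cvalP m.
  elim: k => [|k IH]; first by rewrite !expr0 mulr1.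
  rewrite [LHS]exprS IH mulrA -cm mE [z ^+ k.+1]exprSr [_ ^+ k.+1]exprS.
  by rewrite !mulrA.
have /negP := mP; apply; apply: (@prime_idealX _ P m n).
(* Since [m] is central, m^n = z^n w^n = u w^n. Apply [f], which fixes central elements: m^n = u
   f(w^n) lies in [P]. *)
have -> : m ^+ n = Central (f_central ((cval (den r) * b) ^+ n)) * u.
  apply: val_inj; rewrite rmorphXn rmorphM /=.
  have /centralP cu := cvalP u.
  rewrite cu -fZ uE -mX.
  have mf := fZ (m ^+ n) 1; rewrite f1 !mulr1 in mf.
  have mXE : cval (m ^+ n) = cval m ^+ n.
    exact: (rmorphXn (val : center A -> A)).
  by rewrite mXE in mf; exact: esym.
exact: idealMr.
Qed.

End NormalElementObstruction.

(** * The Azumaya locus as the complement of the zeros of z^p *)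

Section QuantumWeylAzumaya.

Variables (R : comNzRingType) (q : R) (p : nat).
Hypotheses (pr_p : prime p) (qnat_p : qnat q p = 0).
Variables (A : algType R) (x y : A).
Hypothesis xy_rel : x * y = q *: (y * x) + 1.
Hypothesis monomial_ind : forall Q : A -> Prop,
  (forall a b, Q a -> Q b -> Q (a + b)) -> (forall k a, Q a -> Q (k *: a)) ->
  (forall i j, Q (y ^+ i * x ^+ j)) -> forall a, Q a.
Local Notation z := (qcomm x y).
Local Notation N := (p.-1 + p.-1)%N.
Local Notation U := ((z ^+ p) ^+ N).

Let p_gt0 : (0 < p)%N. Proof. exact: prime_gt0. Qed.

Lemma central_of_comm c : x * c = c * x -> y * c = c * y -> c \in central A.
Proof.
move=> cx cy; apply/centralP.
apply: monomial_ind => [a b ca cb|k a ca|i j].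
- by rewrite mulrDl mulrDr ca cb.
- by rewrite -scalerAl ca scalerAr.
- apply/commr_sym/commrM; apply/commrX; exact: esym.
Qed.

Lemma qcommXp_central : z ^+ p \in central A.
Proof.
apply: central_of_comm; first exact: (qcommXp_x xy_rel qnat_p).
exact/esym/(qcommXp_y xy_rel qnat_p).
Qed.

Let u_central a : a * z ^+ p = z ^+ p * a.
Proof. by have /centralP := qcommXp_central. Qed.

Let U_central a : a * U = U * a.
Proof. exact/commrX/u_central. Qed.

Lemma xX_central m : x ^+ (m * p) \in central A.
Proof.
rewrite mulnC exprM; apply: rpredX; apply: central_of_comm.
  by rewrite -exprS -exprSr.
by have [-> _] := qcomm_central xy_rel p_gt0 (qexp_p qnat_p) qnat_p.
Qed.

Lemma yX_central m : y ^+ (m * p) \in central A.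
Proof.
rewrite mulnC exprM; apply: rpredX; apply: central_of_comm.
  by have [_ ->] := qcomm_central xy_rel p_gt0 (qexp_p qnat_p) qnat_p.
by rewrite -exprS -exprSr.
Qed.

Let v : R := sval (cid (qcoef_prod_unit qnat_p pr_p)).
Let vE : qcoef_prod q p p.-1 p.-1 * v = 1.
Proof. by rewrite /v; case: cid. Qed.

Let F i j : A -> A := qcoord x y p v i j.

Let Fop i j : sandwich_op (F i j).
Proof. exact: qcoord_sandwich. Qed.

Let F_monomial i j a b : (i < p)%N -> (j < p)%N -> F i j (y ^+ a * x ^+ b) =
  if (a %% p == i)%N && (b %% p == j)%N
  then U * (y ^+ (a - i) * x ^+ (b - j)) else 0.
Proof. exact: (qcoord_monomial xy_rel pr_p qnat_p u_central). Qed.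

Let sub_mod a i : (a %% p == i)%N -> (a - i = a %/ p * p)%N.
Proof. by move=> /eqP <-; rewrite {1}(divn_eq a p) addnK. Qed.

Let F_central i j : (i < p)%N -> (j < p)%N ->
  forall a, exists2 c, c \in central A & F i j a = U * c.
Proof.
move=> ltip ltjp.
apply: monomial_ind => [a b [c cC ca] [d dC db]|k a [c cC ca]|a b].
- exists (c + d); first exact: rpredD.
  by rewrite (sandwich_opD (Fop i j)) ca db mulrDr.
- exists (k *: c); first exact: rpredZ.
  by rewrite (sandwich_opZ _ _ (Fop i j)) ca scalerAr.
rewrite F_monomial //; case: ifP => [/andP[ai bj]|_].
  exists (y ^+ (a - i) * x ^+ (b - j)) => //.
  rewrite (sub_mod ai) (sub_mod bj); apply: rpredM.
    exact: yX_central.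
  exact: xX_central.
by exists 0; rewrite ?rpred0 ?mulr0.
Qed.

Let F_dual a : U * a =
  \sum_(ij : 'I_p * 'I_p) F ij.1 ij.2 a * (y ^+ ij.1 * x ^+ ij.2).
Proof.
move: a; apply: monomial_ind => [a b ea eb|k a ea|a b].
- rewrite mulrDr ea eb -big_split; apply: eq_bigr => ij _.
  by rewrite (sandwich_opD (Fop _ _)) [RHS]mulrDl.
- rewrite -scalerAr ea scaler_sumr; apply: eq_bigr => ij _.
  by rewrite (sandwich_opZ _ _ (Fop _ _)) [LHS]scalerAl.
pose i := Ordinal (ltn_pmod a p_gt0); pose j := Ordinal (ltn_pmod b p_gt0).
(* Only the index of residues modulo [p] contributes; Euclidean division rebuilds the monomial. *)
rewrite (bigD1 (i, j)) //= F_monomial ?ltn_pmod // !eqxx /= big1 => [|[i' j']].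
  rewrite addr0 !sub_mod // -[RHS]mulrA; congr (_ * _).
  have /centralP xc := xX_central (b %/ p).
  rewrite -[RHS]mulrA [X in _ = _ * X]mulrA -xc -[X in _ = _ * X]mulrA -exprD.
  by rewrite [RHS]mulrA -exprD -!divn_eq.
rewrite xpair_eqE -!val_eqE /= negb_and F_monomial //.
rewrite eq_sym [(val j' == _)]eq_sym.
by case: eqP; case: eqP; rewrite //= mul0r.
Qed.

Hypothesis z_lreg : forall a, z * a = 0 -> a = 0.

(** Makes the quotient of a coordinate by [U] unique, hence additive and linear over the center. *)
Let U_lreg : injective ( *%R U).
Proof.
have zX_lreg n a : z ^+ n * a = 0 -> a = 0.
  elim: n a => [|n IH] a; first by rewrite expr0 mul1r.
  by rewrite exprSr -mulrA => /IH /z_lreg.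
move=> a b ab; apply/eqP; rewrite -subr_eq0; apply/eqP.
by apply: (zX_lreg (p * N)%N); rewrite exprM mulrBr ab subrr.
Qed.

Let z_normal a : exists b, a * z = z * b.
Proof.
move: a; apply: monomial_ind => [a b [c ac] [d bd]|k a [c ac]|i j].
- by exists (c + d); rewrite [LHS]mulrDl [RHS]mulrDr ac bd.
- by exists (k *: c); rewrite -scalerAl ac scalerAr.
have xz := qcommX_xX xy_rel 1 j; have zy := qcommX_yX xy_rel 1 i.
rewrite !mul1n expr1 in xz zy.
(* The scalar is q^(-i), because q^p = 1. *)
have yz : y ^+ i * z = q ^+ (p.-1 * i) *: (z * y ^+ i).
  rewrite zy scalerA -exprD -mulSnr prednK // mulnC -[(i * p)%N]add0n.
  by rewrite (qexp_addMp qnat_p) scale1r.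
exists ((q ^+ j * q ^+ (p.-1 * i)) *: (y ^+ i * x ^+ j)).
rewrite -mulrA xz -scalerAr mulrA yz -scalerAl scalerA -mulrA.
by rewrite -scalerAr.
Qed.

Theorem azumaya_qcommXp (P : prime_idealr (center A)) :
  azumaya (loc_center P) <-> Central qcommXp_central \notin (P : pred _).
Proof.
split=> [az|uP]; last first.
  pose UC := Central qcommXp_central ^+ N.
  have UCE : cval UC = U by exact: (rmorphXn (val : center A -> A)).
  apply: (@azumaya_loc_center _ A P ('I_p * 'I_p)%type
    (fun ij => y ^+ ij.1 * x ^+ ij.2) (fun ij => F ij.1 ij.2) UC).
  - by move=> ij; apply: Fop.
  - move=> [i j] a; have [//|//|c cC ->] := @F_central i j _ _ a.
    by rewrite /= -UCE; apply: rpredM => //; apply: cvalP.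
  - by move=> a; rewrite UCE F_dual.
  - by apply/negP => /prime_idealX; apply/negP.
have F0 := F_central p_gt0 p_gt0.
(* The coordinate of index (0, 0), freed from its factor [U]. *)
pose f a := s2val (cid2 (F0 a)).
have f_central a : f a \in central A by rewrite /f; case: cid2.
have fE a : U * f a = F 0 0 a by rewrite /f; case: cid2.
have p_ndvd : (1 %% p == 0)%N = false by rewrite modn_small ?prime_gt1.
have f_eq a c : F 0 0 a = U * c -> f a = c.
  by move=> Fa; apply: U_lreg; rewrite fE.
have f1 : f 1 = 1.
  apply: f_eq; rewrite -[X in F 0 0 X](mulr1 (y ^+ 0)) -[X in _ * X](expr0 x).
  by rewrite F_monomial // mod0n eqxx /= !subn0 !expr0 mulr1.
apply: (@azumaya_normal_power_notin _ A P z p _ f) => //.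
- move=> a b; apply: f_eq; rewrite mulrDr !fE; exact: sandwich_opD.
- move=> c a; apply: f_eq; rewrite mulrA -U_central -mulrA fE.
  by apply: sandwich_op_centralMl => //; apply/centralP/cvalP.
apply: f_eq; rewrite mulr1; set u := U.
(* In z = (q - 1)yx + 1 the monomial yx has residues (1, 1), so only the term 1 is seen. *)
rewrite [X in F _ _ X](qcommE xy_rel) (sandwich_opD (Fop _ _)).
rewrite (sandwich_opZ _ _ (Fop _ _)) -[y]expr1 -[x]expr1 F_monomial // p_ndvd.
by rewrite /= scaler0 add0r -fE f1 mulr1.
Qed.

Theorem azumaya_one_plus_st (P : prime_idealr (center A)) (c d : center A) :
  odd p -> cval c = x ^+ p -> cval d = y ^+ p ->
  azumaya (loc_center P) <-> 1 + c * d * ((q - 1) ^+ p)%:A \notin (P : pred _).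
Proof.
move=> p_odd cE dE.
suff -> : 1 + c * d * ((q - 1) ^+ p)%:A = Central qcommXp_central.
  exact: azumaya_qcommXp.
apply: val_inj; rewrite [RHS](qcomm_expp pr_p qnat_p xy_rel p_odd).
rewrite -cE -dE mulr_algr; congr (_ + _ *: _).
by have /centralP dC := cvalP d; exact: dC.
Qed.

End QuantumWeylAzumaya.

Theorem theorem3p3 (p : nat) (pr_p : prime p) (p_odd : odd p)
    (P : prime_idealr (C p)) :
  azumaya (loc_center P) <->
  1 + s pr_p * t pr_p * (eta p ^+ p)%:A \notin (P : pred (C p)).
Proof.
have qnat_p : qnat (rho p) p = 0 by exact: rho_sum.
(* Invertibility of [rho p] is what the regularity of [z] rests on. *)
have q_unit : rho p * rho p ^+ p.-1 = 1.
  by rewrite -exprS prednK ?prime_gt0 // rho_exp.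
have ind := @qweyl_ind _ (rho p).
have lreg b := @qcomm_lreg _ (rho p) _ b q_unit.
exact: (@azumaya_one_plus_st (Zrho p) (rho p) p pr_p qnat_p (B p) (x p) (y p)
  (xyE p) ind lreg P (s pr_p) (t pr_p) p_odd erefl erefl).
Qed.
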